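(* Let $H$ be a real Hilbert space, let $g:H\to(-\infty,+\infty]$ be a proper, lower semicontinuous, convex function, and let $f:H\to\mathbb R$ be convex and differentiable with a $1/\beta$-Lipschitz continuous gradient, where $\beta>0$. Let $\Omega$ be the set of solutions of the problem $\min_{x\in H} f(x)+g(x)$, and assume $\Omega\neq\emptyset$. Let $\alpha>0$, $\{\eta_k\}_{k\in\mathbb N}\in\ell^1_+(\mathbb N)$ and $\{U_k\}_{k\in\mathbb N}\subset\mathcal P_\alpha(H)$ be such that $\mu:=\sup_{k\in\mathbb N}\|U_k\|<+\infty$ and $(1+\eta_k)U_{k+1}\succeq U_k$ for all $k\in\mathbb N$. Let $\gamma_k\in(0,\frac{2\beta}{\|U_k\|})$ and $\lambda_k\in(0,\frac1{\alpha_k})$, where $\alpha_k=\frac{2\beta}{4\beta-\gamma_k\|U_k\|}$, for all $k\in\mathbb N$. Let $\{a_k\},\{b_k\}$ be sequences in $H$ with $\sum_{k=0}^{+\infty}\lambda_k\|a_k\|<+\infty$ and $\sum_{k=0}^{+\infty}\lambda_k\|b_k\|<+\infty$. Assume moreover that at least one of the following two sets of conditions holds, where $\underline\lambda,\tau,\underline\gamma,\epsilon$ are constants and the inequalities hold for all $k$: (A) $0<\underline\lambda\le\lambda_k\le\frac1{\alpha_k}-\tau$ with $\tau\in(0,\frac1{\alpha_k}-\underline\lambda)$; and $0<\underline\gamma\le\gamma_k\le\frac{2\beta-\epsilon}{\mu}$ with $\epsilon\in(0,2\beta-\mu\underline\gamma)$. (B) $\sum_{k=0}^{+\infty}\lambda_k(\frac1{\alpha_k}-\lambda_k)=+\infty$;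 $0<\underline\gamma\le\gamma_k\le\frac{2\beta-\epsilon}{\mu}$ with $\epsilon\in(0,2\beta-\mu\underline\gamma)$; $\sum_{k=0}^{+\infty}|\gamma_{k+1}-\gamma_k|<+\infty$, $\sum_{k=0}^{+\infty}\big|\gamma_{k+1}\|U_{k+1}\|-\gamma_k\|U_k\|\big|<+\infty$, and $\sum_{k=0}^{+\infty}\|U_k^{-1}x-U_{k+1}^{-1}x\|<+\infty$ for any $x\in H$; and $\lambda_k\ge\underline\lambda>0$. Let $x_0\in H$ and, for $k\in\mathbb N$, set $$y_k=x_k-\gamma_kU_k(\nabla f(x_k)+b_k),\qquad x_{k+1}=x_k+\lambda_k\big(\mathrm{prox}^{U_k^{-1}}_{\gamma_kg}(y_k)+a_k-x_k\big).$$ Then the following hold: (i) For any $x^*\in\Omega$, $\lim_{k\to+\infty}\|x_k-x^*\|_{U_k^{-1}}$ exists; (ii) $\lim_{k\to+\infty}\|x_k-\mathrm{prox}^{U_k^{-1}}_{\gamma_kg}(x_k-\gamma_kU_k\nabla f(x_k))\|=0$; (iii) $\{x_k\}$ converges weakly to a point in $\Omega$; (iv) $\nabla f(x_k)\to\nabla f(x^* )$ strongly as $k\to+\infty$, where $x^*\in\Omega$.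
   Context: $\mathbb N$ is the set of nonnegative integers, and $\ell^1_+(\mathbb N)$ is the set of summable sequences in $[0,+\infty)$. For bounded self-adjoint linear operators $U,V$ on $H$, $U\succeq V$ means $\langle Ux,x\rangle\ge\langle Vx,x\rangle$ for all $x\in H$; $\mathcal P_\alpha(H)$ is the set of bounded self-adjoint linear operators $U$ on $H$ with $U\succeq\alpha I$. $\|U\|$ is the operator norm. For a strongly positive self-adjoint bounded operator $W$, $\|x\|_W=\sqrt{\langle Wx,x\rangle}$, and for a proper lower semicontinuous convex $h:H\to(-\infty,+\infty]$, $\mathrm{prox}^W_h(x)=\arg\min_{y\in H}\big(\frac12\|x-y\|_W^2+h(y)\big)$. *)

(* Defs.v *)
From HB Require Import structures.
From mathcomp Require Import all_boot all_order all_algebra sesquilinear.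
From mathcomp Require Import all_classical all_reals all_analysis.

Set Implicit Arguments.
Unset Strict Implicit.
Unset Printing Implicit Defensive.

Import Order.TTheory GRing.Theory Num.Theory.
Import numFieldNormedType.Exports.

Local Open Scope classical_set_scope.
Local Open Scope ring_scope.

Section HilbertDefs.
Context {R : realType} {H : completeNormedModType R}.

(* A real Hilbert space is a complete normed space [H] together with a positive
   definite symmetric bilinear form inducing its norm. *)
Definition induces_norm (dot : {dot H for idfun}) : Prop :=
  forall x : H, `|x| = Num.sqrt (dot x x).

Variable dot : {dot H for idfun}.

Definition self_adjoint (U : H -> H) : Prop :=
  forall x y, dot (U x) y = dot x (U y).

Definition loewner_ge (U V : H -> H) : Prop :=
  forall x, dot (V x) x <= dot (U x) x.

Definition strongly_positive_ops (alpha : R) : set {linear H -> H} :=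
  [set U | [/\ bounded_near U (nbhs (0 : H)), self_adjoint U &
               loewner_ge U (fun x => alpha *: x)]].

(* Only meaningful for a bounded operator, the real [sup] being 0 otherwise. *)
Definition opnorm (U : {linear H -> H}) : R :=
  sup [set `|U x| | x in [set x : H | `|x| <= 1]].

(* The elements of [strongly_positive_ops alpha] with 0 < alpha are bijective,
   so that this is a two-sided inverse there. *)
Definition opinv (U : {linear H -> H}) : H -> H := pinv [set: H] U.

Definition wnorm (W : H -> H) (x : H) : R := Num.sqrt (dot (W x) x).

Definition proper_fun (g : H -> \bar R) : Prop :=
  (forall x, -oo < g x)%E /\ (exists x, g x < +oo)%E.

(* At the endpoints [t = 0, 1] the convention 0 * +oo = 0 makes the inequality
   trivial. *)
Definition convex_efun (g : H -> \bar R) : Prop :=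
  forall (t : R) (x y : H), 0 <= t -> t <= 1 ->
    (g (t *: x + (1 - t) *: y)%R <= t%:E * g x + (1 - t)%:E * g y)%E.

Definition argmin (F : H -> \bar R) : set H :=
  [set x | forall y, (F x <= F y)%E].

Definition prox (W : H -> H) (h : H -> \bar R) (x : H) : H :=
  get (argmin (fun y => (2^-1 * wnorm W (x - y) ^+ 2)%:E + h y)%E).

(* The Riesz representative of the Frechet differential. *)
Definition gradient (f : H -> R) (x : H) : H :=
  get [set v : H | forall h : H, 'd f x h = dot v h].

Definition weakly_cvg (u : nat -> H) (l : H) : Prop :=
  forall h, dot (u k) h @[k --> \oo] --> dot l h.

End HilbertDefs.

(* Main.v *)
Require Import Defs.
From HB Require Import structures.
From mathcomp Require Import all_boot all_order all_algebra sesquilinear.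
From mathcomp Require Import all_classical all_reals all_analysis.
From mathcomp Require Import ring lra.

Set Implicit Arguments.
Unset Strict Implicit.
Unset Printing Implicit Defensive.

Import Order.TTheory GRing.Theory Num.Theory.
Import numFieldNormedType.Exports.

Local Open Scope classical_set_scope.
Local Open Scope ring_scope.

(** The operator norm of [U k] is written [N k], and [W k] is the inverse of
    [U k]. For a solution [xs], set
    [d k = x k - prox (x k - gamma k U k (grad f (x k)))],
    [z k = x k - xs] and [u k = grad f (x k) - grad f xs].

    Existence. All the objects of the statement come from one minimisation
    lemma, [strongly_convex_argmin]: Riesz representatives (hence the gradient),
    the inverses [W k], and the proximal points. The affine minorant of [g]
    needed there is given by [- grad f xs], which Fermat's rule makes a
    subgradient of [g] at [xs].

    Distances. The subdifferential of [g] is monotone and [grad f] is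
    beta-cocoercive (Baillon-Haddad), and [dot_step_eq] combines these two facts
    into [<W d, z> >= (1 / (2 alpha_k)) <W d, d>]. So one exact relaxed step does
    not increase the distance to [xs] in the metric [W k]. Since [W k.+1] is at
    most [(1 + eta k) W k] and the proximal map is nonexpansive, the errors and
    the changes of metric only contribute summable perturbations, and
    [quasi_fejer_cvg] gives (i). It also shows that the decrease of the squared
    distance during the exact step tends to [0].

    Residuals. The decrease contains the term
    [lambda (1 / alpha_k - lambda) <W d, d>], which carries no information when
    the relaxation approaches its upper limit. It also contains the slacks of
    all the inequalities used, with coefficients bounded below. These slacks
    therefore tend to [0], and on a bounded trajectory this is enough:
    [step_bound] shows that the averagedness inequality cannot be nearly an
    equality at a bounded [z] unless [d] is small, because
    [1 / alpha_k - 1 >= eps / (2 beta)]. Both sets of conditions give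
    [0 < inf lambda], [0 < inf gamma] and [gamma k N k <= 2 beta - eps], so this
    proves (ii). Vanishing slack in Young's inequality means
    that [u - d / (2 beta)] tends to [0], which gives (iv).

    Weak convergence. Weak limits of [x] are taken along ultrafilters
    ([weak_ultra_limit]). Such a limit [q] is a solution: [grad f q = grad f xs]
    by cocoercivity, and [- grad f q] is a subgradient of [g] at [q] by Minty's
    trick ([subgradient_weak_closed]). The metrics converge strongly
    ([monotone_metrics_cvg]), so Opial's argument ([weak_limit_unique]) shows
    that all these limits agree, whence (iii). *)

(** * Quasi-Fejer sequences of real numbers *)

Section RealSequences.
Context {R : realType}.
Implicit Types (u e eta eps m : nat -> R).

Definition bounded_sums e := exists M : R, forall n, \sum_(0 <= k < n) e k <= M.

Lemma bounded_sums_nneseries e : (forall k, 0 <= e k) ->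
  (\sum_(0 <= k <oo) (e k)%:E < +oo)%E -> bounded_sums e.
Proof.
move=> e0 efin.
have fin : (\sum_(0 <= k <oo) (e k)%:E)%E \is a fin_num.
  rewrite ge0_fin_numE//; apply: nneseries_ge0 => k _ _; by rewrite lee_fin.
exists (fine (\sum_(0 <= k <oo) (e k)%:E)%E) => n.
rewrite -lee_fin fineK// -sumEFin.
by apply: nneseries_lim_ge => k _ _; rewrite lee_fin.
Qed.

Lemma bounded_sums_le e1 e2 : (forall k, e1 k <= e2 k) ->
  bounded_sums e2 -> bounded_sums e1.
Proof.
move=> le12 [M HM]; exists M => n; apply: le_trans (HM n).
exact: ler_sum.
Qed.

Lemma bounded_sumsD e1 e2 : bounded_sums e1 -> bounded_sums e2 ->
  bounded_sums (fun k => e1 k + e2 k).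
Proof.
move=> [M1 H1] [M2 H2]; exists (M1 + M2) => n.
by rewrite big_split/= lerD.
Qed.

Lemma bounded_sumsZ (c : R) e : 0 <= c -> bounded_sums e ->
  bounded_sums (fun k => c * e k).
Proof.
move=> c0 [M HM]; exists (c * M) => n.
by rewrite -mulr_sumr ler_wpM2l.
Qed.

Lemma bounded_sums_cvg0 e : (forall k, 0 <= e k) -> bounded_sums e ->
  e k @[k --> \oo] --> (0 : R).
Proof.
move=> e0 [M HM]; apply: cvg_series_cvg_0.
apply: nondecreasing_is_cvgn.
  apply/nondecreasing_seqP => n; rewrite /series/= big_nat_recr//=.
  by rewrite lerDl.
by exists M => _ [n _ <-]; exact: HM.
Qed.

Lemma prod1D_ge1 eta n : (forall k, 0 <= eta k) ->
  1 <= \prod_(0 <= k < n) (1 + eta k).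
Proof.
move=> eta0; elim: n => [|n IH]; first by rewrite big_geq.
by rewrite big_nat_recr//= (le_trans IH)// ler_peMr ?(le_trans ler01)// lerDl.
Qed.

Lemma prod1D_gt0 eta n : (forall k, 0 <= eta k) ->
  0 < \prod_(0 <= k < n) (1 + eta k).
Proof. by move=> /(prod1D_ge1 n); exact: lt_le_trans. Qed.

Lemma prod1D_nondecreasing eta : (forall k, 0 <= eta k) ->
  {homo (fun n => \prod_(0 <= k < n) (1 + eta k)) : i j / (i <= j)%N >-> i <= j}.
Proof.
move=> eta0; apply/nondecreasing_seqP => n; rewrite big_nat_recr//=.
by rewrite ler_peMr ?lerDl// ltW// prod1D_gt0.
Qed.

Lemma prod1D_cvg eta : (forall k, 0 <= eta k) -> bounded_sums eta ->
  cvgn (fun n => \prod_(0 <= k < n) (1 + eta k)).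
Proof.
move=> eta0 [M HM]; apply: nondecreasing_is_cvgn.
  exact: prod1D_nondecreasing.
exists (expR M) => _ [n _ <-].
apply: le_trans (_ : expR (\sum_(0 <= k < n) eta k) <= _); last first.
  by rewrite ler_expR.
elim: n => [|n IH]; first by rewrite !big_geq// expR0.
rewrite !big_nat_recr//= expRD; apply: ler_pM => //.
- exact/ltW/prod1D_gt0.
- by rewrite addr_ge0.
- exact: expR_ge1Dx.
Qed.

(** Division by the partial products of [1 + eta], followed by subtraction of
    the partial sums of [eps], leaves a nonincreasing sequence. *)
Lemma quasi_fejer_cvg u eta eps :
  (forall k, 0 <= u k) -> (forall k, 0 <= eta k) -> (forall k, 0 <= eps k) ->
  bounded_sums eta -> bounded_sums eps ->
  (forall k, u k.+1 <= (1 + eta k) * (u k + eps k)) -> cvgn u.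
Proof.
move=> u0 eta0 eps0 beta [M HM] uS.
pose P n := \prod_(0 <= k < n) (1 + eta k).
have P0 n : 0 < P n by exact: prod1D_gt0.
have P1 n : 1 <= P n by exact: prod1D_ge1.
pose S n := \sum_(0 <= k < n) eps k.
have Scvg : cvgn S.
  apply: nondecreasing_is_cvgn; last by exists M => _ [n _ <-]; exact: HM.
  by apply/nondecreasing_seqP => n; rewrite /S big_nat_recr//= lerDl.
pose v n := u n / P n - S n.
have vcvg : cvgn v.
  apply: nonincreasing_is_cvgn.
    apply/nonincreasing_seqP => n; rewrite /v /S big_nat_recr//=.
    suff : u n.+1 / P n.+1 <= u n / P n + eps n by rewrite /S; lra.
    rewrite ler_pdivrMr// /P big_nat_recr//= -/(P n).
    apply: le_trans (uS n) _.
    have -> : (u n / P n + eps n) * (P n * (1 + eta n)) =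
              (1 + eta n) * (u n + eps n * P n).
      by field; rewrite gt_eqF.
    by rewrite ler_wpM2l ?addr_ge0// lerD2l ler_peMr.
  exists (- M) => _ [n _ <-]; rewrite /v.
  have := HM n; rewrite -/(S n) => SM.
  have : 0 <= u n / P n by rewrite divr_ge0// ltW.
  lra.
have -> : u = (fun n => (v n + S n) * P n).
  by apply/funext => n; rewrite /v subrK divfK ?gt_eqF.
have Pcvg : cvgn P by exact: prod1D_cvg.
by apply: cvgP; apply: cvgM Pcvg; apply: cvgD vcvg Scvg.
Qed.

(** The intermediate sequence is caught between [u k] and a perturbation of [u k.+1]. *)
Lemma quasi_fejer_mid_cvg u m eta eps :
  (forall k, 0 <= eta k) -> (forall k, 0 <= eps k) ->
  bounded_sums eta -> bounded_sums eps -> cvgn u ->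
  (forall k, m k <= u k) ->
  (forall k, u k.+1 <= (1 + eta k) * (m k + eps k)) ->
  m k @[k --> \oo] --> limn u.
Proof.
move=> eta0 eps0 beta beps ucvg mu uS.
have eta_cvg := bounded_sums_cvg0 eta0 beta.
have eps_cvg := bounded_sums_cvg0 eps0 beps.
apply: (@squeeze_cvgr _ _ _ _ (fun k => u k.+1 / (1 + eta k) - eps k) u) => //.
  near=> k; rewrite mu andbT lerBlDr ler_pdivrMr ?ltr_pwDl//.
  by rewrite mulrC.
have -> : limn u = limn u / (1 + 0) - 0 by rewrite addr0 divr1 subr0.
apply: cvgB => //; apply: cvgM; first by rewrite (cvg_shiftS u).
apply: cvgV; first by rewrite addr0 oner_eq0.
by apply: cvgD => //; exact: cvg_cst.
Unshelve. all: by end_near. Qed.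

End RealSequences.

(** * Inner products and positive operators *)

Section QuadraticPolynomials.
Context {R : realType}.
Implicit Types a b c t : R.

Lemma quadratic_ge0_linear_eq0 a b :
  (forall t, 0 <= t * a + t ^+ 2 * b) -> a = 0.
Proof.
move=> h; apply/eqP; apply/negP => /negP a0.
have a2 : 0 < a ^+ 2 by rewrite exprn_even_gt0.
have b0 : 0 < `|b| + 1 by rewrite ltr_wpDl.
have := h (- a / (2 * (`|b| + 1))).
have -> : - a / (2 * (`|b| + 1)) * a + (- a / (2 * (`|b| + 1))) ^+ 2 * b =
   (a ^+ 2 / (4 * (`|b| + 1) ^+ 2)) * (b - 2 * (`|b| + 1)).
  by field; rewrite gt_eqF.
rewrite pmulr_rge0; last by rewrite divr_gt0// mulr_gt0// exprn_gt0.
have := ler_norm b; lra.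
Qed.

Lemma quadratic_ge0_discr a b c : 0 <= c ->
  (forall t, 0 <= a - t * (2 * b) + t ^+ 2 * c) -> b ^+ 2 <= a * c.
Proof.
rewrite le_eqVlt => /predU1P[<-|c0] h.
  have [->|b0] := eqVneq b 0; first by rewrite expr0n mulr0.
  have := h ((a + 1) / (2 * b)).
  by rewrite divfK ?mulf_neq0//; lra.
have := h (b / c).
have -> : a - b / c * (2 * b) + (b / c) ^+ 2 * c = (a * c - b ^+ 2) / c.
  by field; rewrite gt_eqF.
by rewrite pmulr_lge0 ?invr_gt0// subr_ge0.
Qed.

End QuadraticPolynomials.

Section InnerProduct.
Context {R : realType} {H : completeNormedModType R}.
Variable dot : {dot H for idfun}.
Implicit Types (x y z : H) (t : R).

Lemma dotC x y : dot x y = dot y x.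
Proof. by rewrite hermC expr0 mul1r. Qed.

Lemma dotDl x y z : dot (x + y) z = dot x z + dot y z.
Proof. exact: linearDl. Qed.

Lemma dotDr x y z : dot x (y + z) = dot x y + dot x z.
Proof. exact: linearDr. Qed.

Lemma dotNl x y : dot (- x) y = - dot x y.
Proof. exact: linearNl. Qed.

Lemma dotNr x y : dot x (- y) = - dot x y.
Proof. exact: linearNr. Qed.

Lemma dotZl t x y : dot (t *: x) y = t * dot x y.
Proof. by rewrite linearZl_LR. Qed.

Lemma dotZr t x y : dot x (t *: y) = t * dot x y.
Proof. by rewrite linearZr_LR. Qed.

Lemma dot0l x : dot 0 x = 0.
Proof. exact: linear0l. Qed.

Lemma dot0r x : dot x 0 = 0.
Proof. exact: linear0r. Qed.

Definition dotE := (dotDl, dotDr, dotNl, dotNr, dotZl, dotZr).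

Lemma dot_ge0 x : 0 <= dot x x.
Proof.
by have [->|x0] := eqVneq x 0; rewrite ?dot0l// ltW// neq0_dnorm_gt0.
Qed.

Section PositiveOperators.
Variable A : {linear H -> H}.
Hypotheses (Asym : self_adjoint dot A) (A0 : forall x, 0 <= dot (A x) x).

(** Positivity of the form at [x - t y] for all [t] makes a discriminant
    nonpositive. The inequality is applied to semidefinite differences such as
    [N W - I]. *)
Lemma psd_cauchy_schwarz x y :
  dot (A x) y ^+ 2 <= dot (A x) x * dot (A y) y.
Proof.
apply: quadratic_ge0_discr => // t.
have := A0 (x - t *: y).
rewrite (linearB A) (linearZ_LR A)/= !dotE (Asym y x) (dotC y (A x)).
by congr (_ <= _); ring.
Qed.

Lemma wnorm_ge0 x : 0 <= wnorm dot A x.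
Proof. exact: sqrtr_ge0. Qed.

Lemma sqr_wnorm x : wnorm dot A x ^+ 2 = dot (A x) x.
Proof. by rewrite sqr_sqrtr. Qed.

Lemma dot_le_wnorm x y : dot (A x) y <= wnorm dot A x * wnorm dot A y.
Proof.
rewrite /wnorm -sqrtrM//; apply: le_trans (ler_norm _) _.
by rewrite -sqrtr_sqr ler_wsqrtr// psd_cauchy_schwarz.
Qed.

Lemma ler_wnormD x y : wnorm dot A (x + y) <= wnorm dot A x + wnorm dot A y.
Proof.
rewrite -(@ler_pXn2r _ 2)// ?nnegrE ?addr_ge0 ?wnorm_ge0//.
rewrite sqrrD !sqr_wnorm (linearD A) !dotE (Asym y x) (dotC y (A x)).
by have := dot_le_wnorm x y; lra.
Qed.

Lemma wnormZ t x : 0 <= t -> wnorm dot A (t *: x) = t * wnorm dot A x.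
Proof.
move=> t0; rewrite /wnorm (linearZ_LR A)/= !dotE mulrA -expr2 sqrtrM ?sqr_ge0//.
by rewrite sqrtr_sqr ger0_norm.
Qed.

Lemma wnormN x : wnorm dot A (- x) = wnorm dot A x.
Proof. by rewrite /wnorm (linearN A) !dotE opprK. Qed.

End PositiveOperators.

Section InducedNorm.
Hypothesis hdot : induces_norm dot.

Lemma dotxx x : dot x x = `|x| ^+ 2.
Proof. by rewrite hdot sqr_sqrtr// dot_ge0. Qed.

Lemma dot_le_norm x y : `|dot x y| <= `|x| * `|y|.
Proof.
rewrite -(@ler_pXn2r _ 2)// ?nnegrE ?mulr_ge0// real_normK ?num_real//.
rewrite exprMn -!dotxx.
have sid : self_adjoint dot (idfun : {linear H -> H}) by [].
exact: (psd_cauchy_schwarz sid (fun x => dot_ge0 x)).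
Qed.

Lemma dot_polarization x y : dot x y = 4^-1 * (`|x + y| ^+ 2 - `|x - y| ^+ 2).
Proof. by rewrite -!dotxx !dotE (dotC y x); field. Qed.

Lemma dot_eq0 x : (forall y, dot x y = 0) -> x = 0.
Proof.
by move=> /(_ x); rewrite dotxx => /eqP; rewrite sqrf_eq0 normr_eq0 => /eqP.
Qed.

Lemma cvg_dot (T : Type) (F : set_system T) (FF : Filter F) (u v : T -> H) l m :
  u @ F --> l -> v @ F --> m -> dot (u i) (v i) @[i --> F] --> dot l m.
Proof.
move=> ul vm; under eq_fun do rewrite dot_polarization !expr2.
have cD : `|u x + v x| @[x --> F] --> `|l + m|.
  by apply: cvg_norm; apply: cvgD.
have cB : `|u x - v x| @[x --> F] --> `|l - m|.
  by apply: cvg_norm; apply: cvgB.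
rewrite dot_polarization !expr2; apply: cvgM; first exact: cvg_cst.
by apply: (@cvgB _ _ _ F FF); apply: cvgM.
Qed.

Lemma continuous_dot_op (A : {linear H -> H}) : continuous A ->
  continuous (fun x => dot (A x) x).
Proof. by move=> Ac x; apply: cvg_dot => //; exact: Ac. Qed.

Lemma cvg_dot_bounded0 (T : Type) (F : set_system T) (FF : Filter F)
    (u v : T -> H) (M : R) :
  u @ F --> (0 : H) -> (forall i, `|v i| <= M) ->
  dot (u i) (v i) @[i --> F] --> (0 : R).
Proof.
move=> u0 vM; apply/norm_cvg0P.
apply: (@squeeze_cvgr _ _ _ _ (fun=> 0) (fun i => `|u i| * M)).
- near=> i; rewrite normr_ge0/= (le_trans (dot_le_norm _ _))//.
  by rewrite ler_wpM2l.
- exact: cvg_cst.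
- rewrite -[X in _ --> X](mul0r M) -[X in X * M](@normr0 _ H).
  by apply: cvgM; [exact: cvg_norm|exact: cvg_cst].
Unshelve. all: by end_near. Qed.

Section BoundedPositive.
Variables (A : {linear H -> H}).
Hypotheses (Asym : self_adjoint dot A) (A0 : forall x, 0 <= dot (A x) x).

(** The Cauchy-Schwarz inequality of the form of [A], applied to [x] and [A x],
    bounds [|A x|^4] by [<A x, x>] times the form at [A x]. *)
Lemma psd_sqr_norm_le (C : R) x : (forall y, dot (A y) y <= C * `|y| ^+ 2) ->
  `|A x| ^+ 2 <= C * dot (A x) x.
Proof.
move=> AC; have [->|Ax0] := eqVneq (A x) 0.
  by rewrite normr0 expr0n dot0l mulr0.
have Axgt0 : 0 < `|A x| ^+ 2 by rewrite exprn_gt0// normr_gt0.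
rewrite -(ler_pM2r Axgt0) -{1 2}dotxx -expr2.
apply: le_trans (psd_cauchy_schwarz Asym A0 x (A x)) _.
by rewrite mulrAC mulrC ler_wpM2r.
Qed.

End BoundedPositive.

Section OperatorNorm.
Variable U : {linear H -> H}.
Hypothesis Ubnd : bounded_near U (nbhs (0 : H)).

Lemma bounded_op_le : exists2 M : R, 0 < M & forall x, `|U x| <= M * `|x|.
Proof.
have /linear_boundedP := Ubnd.
move=> /pinfty_ex_gt0[M M0 HM]; by exists M.
Qed.

Lemma le_opnorm x : `|U x| <= opnorm U * `|x|.
Proof.
have [M M0 HM] := bounded_op_le.
have [->|x0] := eqVneq x 0; first by rewrite (linear0 U) !normr0 mulr0.
have nx : 0 < `|x| by rewrite normr_gt0.
rewrite -ler_pdivrMr//.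
have -> : `|U x| / `|x| = `|U (`|x|^-1 *: x)|.
  by rewrite (linearZ_LR U)/= normrZ normfV normr_id mulrC.
apply: ub_le_sup; last first.
  exists (`|x|^-1 *: x) => //=.
  by rewrite normrZ normfV normr_id mulVf// gt_eqF.
exists M => _ [y /= y1 <-]; apply: le_trans (HM y) _.
by rewrite ler_piMr// ltW.
Qed.

Lemma opnorm_ge0 : 0 <= opnorm U.
Proof.
have [M M0 HM] := bounded_op_le.
apply: le_trans (_ : `|U 0| <= _) => //; apply: ub_le_sup; last first.
  by exists 0 => //=; rewrite normr0.
exists M => _ [y /= y1 <-]; apply: le_trans (HM y) _.
by rewrite ler_piMr// ltW.
Qed.

Lemma dot_op_le x : dot (U x) x <= opnorm U * `|x| ^+ 2.
Proof.
apply: le_trans (ler_norm _) _; apply: le_trans (dot_le_norm _ _) _.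
by rewrite expr2 mulrA ler_wpM2r// le_opnorm.
Qed.

End OperatorNorm.

End InducedNorm.
End InnerProduct.

(** * Minimisation of strongly convex functions *)

Section Minimisation.
Context {R : realType} {H : completeNormedModType R}.
Variable dot : {dot H for idfun}.
Hypothesis hdot : induces_norm dot.

(** Strong convexity of the finite part makes minimising sequences Cauchy, so
    completeness replaces any compactness argument. *)
Lemma strongly_convex_argmin (Q : H -> R) (h : H -> \bar R) (c m : R) :
  0 < c -> continuous Q ->
  (forall x y, Q (2^-1 *: (x + y)) + c * `|x - y| ^+ 2 <= 2^-1 * (Q x + Q y)) ->
  lower_semicontinuous h -> convex_efun h -> proper_fun h ->
  (forall x, m%:E <= (Q x)%:E + h x)%E ->
  argmin (fun x => (Q x)%:E + h x)%E !=set0.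
Proof.
move=> c0 Qc Qmid hlsc hconv [hNy [x0 hx0]] hm.
have hfin x : (h x < +oo)%E -> h x = (fine (h x))%:E.
  by move=> hx; rewrite fineK// fin_numElt hNy hx.
pose D := [set r : R | exists2 x, (h x < +oo)%E & r = Q x + fine (h x)].
have hD : has_inf D.
  split; first by exists (Q x0 + fine (h x0)), x0.
  exists m => _ [x hx ->]; rewrite -lee_fin EFinD -hfin//.
set I := inf D.
have leI x r : h x = r%:E -> I <= Q x + r.
  move=> hx; apply: ge_inf; first exact: hD.2.
  by exists x; rewrite hx ?ltry.
have ex_seq n : exists xr : H * R,
    h xr.1 = xr.2%:E /\ Q xr.1 + xr.2 < I + n.+1%:R^-1.
  have [_ [x hx ->] lt] := inf_adherent (ltac:(by []) : 0 < n.+1%:R^-1 :> R) hD.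
  by exists (x, fine (h x)) => /=; rewrite -hfin.
have [s hs] := choice ex_seq.
pose u n := (s n).1; pose r n := (s n).2.
have hu n : h (u n) = (r n)%:E by case: (hs n).
have ltI n : Q (u n) + r n < I + n.+1%:R^-1 by case: (hs n).
have close p q : c * `|u p - u q| ^+ 2 <= 2^-1 * (p.+1%:R^-1 + q.+1%:R^-1).
  have hmid : (h (2^-1 *: (u p + u q)) <= (2^-1 * (r p + r q))%:E)%E.
    have h0 : 0 <= 2^-1 :> R by rewrite invr_ge0.
    have h1 : 2^-1 <= 1 :> R by lra.
    have := @hconv 2^-1 (u p) (u q) h0 h1.
    have -> : 1 - 2^-1 = 2^-1 :> R by field.
    rewrite !hu.
    by rewrite scalerDr -!EFinM -EFinD mulrDr.
  have fmid := hfin _ (le_lt_trans hmid (ltry _)).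
  have := leI _ _ fmid; rewrite fmid lee_fin in hmid.
  move: (Qmid (u p) (u q)) (ltI p) (ltI q) hmid.
  move: (p.+1%:R^-1 : R) (q.+1%:R^-1 : R) => ip iq; lra.
have ucauchy : cauchy_ex (u @ \oo).
  move=> e e0; have ce : 0 < c * e ^+ 2 by rewrite mulr_gt0// exprn_gt0.
  have [N _ HN] := @near_infty_natSinv_lt R (PosNum ce).
  exists (u N); exists N => // n /= Nn.
  rewrite -ball_normE/=.
  rewrite -(@ltr_pXn2r _ 2)// ?nnegrE ?(ltW e0)//.
  rewrite -(ltr_pM2l c0); apply: le_lt_trans (close _ _) _.
  move: (HN N (leqnn _)) (HN n Nn) => /=.
  by move: (N.+1%:R^-1 : R) (n.+1%:R^-1 : R) => ip iq; lra.
have ucvg : cvgn u by apply/cauchy_cvgP; exact: cauchy_exP.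
pose p := limn u; have up : u n @[n --> \oo] --> p by exact: ucvg.
exists p => y.
suff : (h p <= (I - Q p)%:E)%E.
  move=> hp; have fp := hfin _ (le_lt_trans hp (ltry _)).
  rewrite fp lee_fin in hp.
  have [hy|] := ltP (h y) +oo%E; last first.
    by rewrite leye_eq => /eqP ->; rewrite addey// leey.
  rewrite fp (hfin _ hy) -!EFinD lee_fin.
  by have := leI _ _ (hfin _ hy); lra.
rewrite leNgt; apply/negP => lthp.
have [d d0 hd] : exists2 d : R, 0 < d & ((I - Q p + d)%:E < h p)%E.
  move: lthp; case: (h p) => [t||//]; rewrite ?lte_fin => lt; last first.
    by exists 1; rewrite ?ltry.
  by exists (2^-1 * (t - (I - Q p))); rewrite ?lte_fin; lra.
have [V Vp HV] := hlsc _ _ hd.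
have d2 : 0 < 2^-1 * d by rewrite mulr_gt0.
have nV : \forall n \near \oo, V (u n) by exact: up.
have nQ : \forall n \near \oo, `|Q p - Q (u n)| < 2^-1 * d.
  have /cvgrPdist_lt/(_ _ d2) : Q (u n) @[n --> \oo] --> Q p.
    exact: (cvg_comp _ _ up (Qc p)).
  by [].
have [N _ HN] := @near_infty_natSinv_lt R (PosNum d2).
near \oo => n.
have Vn : V (u n) by near: n.
have Qn : `|Q p - Q (u n)| < 2^-1 * d by near: n.
have Nn : (N <= n)%N by near: n; exact: nbhs_infty_ge.
have := HV _ Vn; rewrite hu lte_fin.
move: (HN n Nn) (ltI n) => /=; move: (n.+1%:R^-1 : R) => ip.
by move: Qn; rewrite ltr_norml => /andP[]; lra.
Unshelve. all: by end_near. Qed.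

Lemma convex_efun0 : convex_efun (fun _ : H => 0%E : \bar R).
Proof. by move=> t x y _ _; rewrite !mule0 adde0. Qed.

Lemma proper_fun0 : proper_fun (fun _ : H => 0%E : \bar R).
Proof. by split=> [x|]; [rewrite ltNy0|exists 0; rewrite lt0y]. Qed.

Lemma lower_semicontinuous0 : lower_semicontinuous (fun _ : H => 0%E : \bar R).
Proof. by move=> x a a0; exists setT => //; exact: filterT. Qed.

Section Coercive.
Variables (A : {linear H -> H}) (a : R).
Hypotheses (Ac : continuous A) (Asym : self_adjoint dot A) (a0 : 0 < a)
  (Aa : forall x, a * `|x| ^+ 2 <= dot (A x) x).

Lemma coercive_midpoint x y :
  dot (A (2^-1 *: (x + y))) (2^-1 *: (x + y)) + 4^-1 * a * `|x - y| ^+ 2 <=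
  2^-1 * (dot (A x) x + dot (A y) y).
Proof.
have := Aa (x - y).
rewrite (linearB A) (linearZ_LR A)/= (linearD A) !dotE.
by rewrite (Asym y x) (dotC dot y (A x)); lra.
Qed.

(** The representative minimises [x |-> <A x, x> / 2 - L x]: coercivity makes
    this function strongly convex, and its first variation vanishes at the
    minimiser. With [A] the identity this is the Riesz theorem, and with
    [L = <y, .>] it solves [A x = y]. *)
Lemma coercive_riesz (L : {linear H -> R}) (M : R) : continuous L ->
  (forall x, `|L x| <= M * `|x|) -> exists p, forall v, L v = dot (A p) v.
Proof.
move=> Lc LM.
pose Q x := 2^-1 * dot (A x) x - L x.
have Qc : continuous Q.
  move=> x; apply: cvgB; last exact: Lc.
  by apply: cvgM; [exact: cvg_cst|exact: (continuous_dot_op hdot Ac)].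
have [|||p /= pmin] := @strongly_convex_argmin Q (fun=> 0%E) (8^-1 * a)
    (- (2^-1 * M ^+ 2 / a)) _ Qc _ lower_semicontinuous0 convex_efun0 proper_fun0.
- by rewrite mulr_gt0.
- move=> x y; have := coercive_midpoint x y.
  by rewrite /Q (linearZ_LR L)/= (linearD L) /GRing.scale/=; lra.
- move=> x; rewrite adde0 lee_fin /Q.
  have : 0 <= (a * `|x| - M) ^+ 2 / a by rewrite divr_ge0 ?sqr_ge0// ltW.
  have -> : (a * `|x| - M) ^+ 2 / a =
      a * `|x| ^+ 2 - 2 * (M * `|x|) + M ^+ 2 / a by field; rewrite gt_eqF.
  by have := Aa x; have := ler_norm (L x); have := LM x; lra.
exists p => v; apply/esym/eqP; rewrite -subr_eq0; apply/eqP.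
apply: (@quadratic_ge0_linear_eq0 _ _ (2^-1 * dot (A v) v)) => t.
have := pmin (p + t *: v); rewrite !adde0 lee_fin /Q.
rewrite !(linearD A) !(linearD L) (linearZ_LR A) (linearZ_LR L)/= /GRing.scale/=.
by rewrite !dotE (Asym v p) (dotC dot v (A p)); lra.
Qed.

Lemma coercive_surj y : exists x, A x = y.
Proof.
have [] := @coercive_riesz (dot y) `|y|.
- move=> x; apply: (@cvg_dot _ _ _ hdot) => //; exact: cvg_cst.
- by move=> x; exact: dot_le_norm.
move=> p Hp; exists p; apply/eqP; rewrite -subr_eq0; apply/eqP.
by apply: (dot_eq0 hdot) => z; rewrite !dotE -Hp subrr.
Qed.

Lemma coercive_inj : injective A.
Proof.
move=> x y Axy; apply/eqP; rewrite -subr_eq0 -normr_eq0 -sqrf_eq0.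
have := Aa (x - y); rewrite (linearB A) Axy subrr dot0l pmulr_rle0// => le0.
by rewrite eq_le le0 sqr_ge0.
Qed.

End Coercive.

Lemma riesz (L : {linear H -> R}) : continuous L ->
  exists p, forall v, L v = dot p v.
Proof.
move=> Lc.
have [M M0 LM] : exists2 M : R, 0 < M & forall x, `|L x| <= M * `|x|.
  have /linear_boundedP : bounded_near L (nbhs (0 : H)).
    exact/linear_bounded_continuous.
  by move=> /pinfty_ex_gt0[M M0 HM]; exists M.
apply: (@coercive_riesz (idfun : {linear H -> H}) 1 _ _ _ _ L M) => //.
- by move=> x; exact: cvg_id.
- by move=> x; rewrite mul1r -(dotxx hdot).
Qed.

End Minimisation.

(** * Inverses of strongly positive operators *)

Section InverseOperator.
Context {R : realType} {H : completeNormedModType R}.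
Variable dot : {dot H for idfun}.
Hypothesis hdot : induces_norm dot.
Variables (alpha : R) (U : {linear H -> H}).
Hypotheses (alpha0 : 0 < alpha) (Upos : strongly_positive_ops dot alpha U).

Let Ubnd : bounded_near U (nbhs (0 : H)). Proof. by case: Upos. Qed.

Let Usym : self_adjoint dot U. Proof. by case: Upos. Qed.

Lemma strongly_positiveP x : alpha * `|x| ^+ 2 <= dot (U x) x.
Proof. by case: Upos => _ _ /(_ x); rewrite dotZl (dotxx hdot). Qed.

Let Upsd x : 0 <= dot (U x) x.
Proof. by apply: le_trans (strongly_positiveP x); rewrite mulr_ge0// ltW. Qed.

Lemma opinv_linear : exists W : {linear H -> H},
  [/\ opinv U = W, cancel W U & cancel U W].
Proof.
have Uc : continuous U by exact: bounded_linear_continuous.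
have Uinj := coercive_inj alpha0 strongly_positiveP.
have Usurj y : exists x, U x = y.
  exact: (coercive_surj hdot Uc Usym alpha0 strongly_positiveP).
have WK : cancel (opinv U) U.
  move=> y; rewrite /opinv pinvK// inE/=.
  by have [x <-] := Usurj y; exists x.
have UK : cancel U (opinv U) by move=> x; apply: Uinj; rewrite WK.
have Wlin : linear (opinv U).
  by move=> t x y; apply: Uinj; rewrite WK (linearP U) !WK.
pose W : {linear H -> H} := HB.pack (opinv U) (GRing.isLinear.Build _ _ _ _ _ Wlin).
by exists W.
Qed.

Section Inverse.
Variable W : {linear H -> H}.
Hypotheses (WK : cancel W U) (UK : cancel U W).

Lemma opinv_self_adjoint : self_adjoint dot W.
Proof. by move=> x y; rewrite -{2}(WK x) Usym WK. Qed.

Lemma opinv_coercive x : alpha * `|W x| ^+ 2 <= dot (W x) x.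
Proof. by rewrite -{3}(WK x) dotC; exact: strongly_positiveP. Qed.

Lemma opinv_psd x : 0 <= dot (W x) x.
Proof. by apply: le_trans (opinv_coercive x); rewrite mulr_ge0// ltW. Qed.

Lemma opinv_norm_le x : `|W x| <= alpha^-1 * `|x|.
Proof.
have [->|Wx0] := eqVneq (W x) 0.
  by rewrite normr0 mulr_ge0// invr_ge0 ltW.
rewrite ler_pdivlMl//.
have W0 : 0 < `|W x| by rewrite normr_gt0.
rewrite -(ler_pM2r W0) -mulrA -expr2 mulrC.
apply: le_trans (_ : dot (W x) x <= _); first by rewrite mulrC opinv_coercive.
by rewrite (mulrC `|x|) (le_trans (ler_norm _))// dot_le_norm.
Qed.

Lemma opinv_dot_le x : dot (W x) x <= alpha^-1 * `|x| ^+ 2.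
Proof.
apply: le_trans (ler_norm _) _; apply: le_trans (dot_le_norm hdot _ _) _.
by rewrite expr2 mulrA ler_wpM2r// opinv_norm_le.
Qed.

Lemma opinv_continuous : continuous W.
Proof.
apply: bounded_linear_continuous; apply/bounded_funP => r.
exists (alpha^-1 * r) => x xr; apply: le_trans (opinv_norm_le x) _.
by rewrite ler_wpM2l// invr_ge0 ltW.
Qed.

Lemma sqr_norm_le_opinv x : `|x| ^+ 2 <= opnorm U * dot (W x) x.
Proof.
have := psd_sqr_norm_le hdot Usym Upsd (W x) (dot_op_le hdot Ubnd).
by rewrite WK (dotC dot x).
Qed.

End Inverse.
End InverseOperator.

Section LoewnerOrder.
Context {R : realType} {H : completeNormedModType R}.
Variable dot : {dot H for idfun}.
Variables (U1 U2 W1 W2 : {linear H -> H}) (c : R).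
Hypotheses (U1sym : self_adjoint dot U1) (U1psd : forall x, 0 <= dot (U1 x) x).
Hypotheses (WK1 : cancel W1 U1) (WK2 : cancel W2 U2).

(** The inverse [W] of a positive [U] satisfies
    [<W x, x> = max_u (2 <x, u> - <U u, u>)], which decreases when [U] grows. *)
Lemma loewner_ge_inv : 0 < c ->
  loewner_ge dot (fun x => c *: U2 x) U1 ->
  forall x, dot (W2 x) x <= c * dot (W1 x) x.
Proof.
move=> c0 hU x.
(* The maximiser of the formula for [c U2]. *)
have [u uE] : exists u, u = c^-1 *: W2 x by exists (c^-1 *: W2 x).
have hu : dot (U1 u) u <= c^-1 * dot (W2 x) x.
  apply: le_trans (hU u) _.
  rewrite uE (linearZ_LR U2)/= WK2 !dotE (dotC dot x).
  by rewrite mulrA divff ?gt_eqF// mul1r.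
have := U1psd (W1 x - u).
rewrite (linearB U1) WK1 !dotE (U1sym u (W1 x)) WK1.
rewrite (dotC dot x u) (dotC dot x (W1 x)).
have -> : dot u x = c^-1 * dot (W2 x) x by rewrite uE !dotE.
move=> h; rewrite -ler_pdivrMl//; lra.
Qed.

End LoewnerOrder.

(** * Convex functions with Lipschitz gradient *)

Section DifferentiableConvex.
Context {R : realType} {H : completeNormedModType R}.
Variable dot : {dot H for idfun}.
Hypothesis hdot : induces_norm dot.
Variable f : H -> R.
Hypotheses (fconv : convex_function [set: H] f)
  (fdiff : forall x : H, differentiable f x).
Local Notation grad := (gradient dot f).

Lemma gradientP x h : 'd f x h = dot (grad x) h.
Proof.
have [p Hp] := riesz hdot (diff_continuous (fdiff x)).
have := @getPex _ [set v : H | forall h : H, 'd f x h = dot v h].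
by rewrite -/(gradient dot f x) => /=; apply; exists p.
Qed.

Lemma convex_functionE (t : R) x y : 0 <= t -> t <= 1 ->
  f (t *: x + (1 - t) *: y) <= t * f x + (1 - t) * f y.
Proof.
move=> t0 t1; have := @fconv (Itv01 t0 t1) x y.
by rewrite !inE; move=> /(_ I I).
Qed.

Lemma gradient_ineq x y : f x + dot (grad x) (y - x) <= f y.
Proof.
have D : (fun t => t^-1 *: ((f \o shift x) (t *: (y - x)) - f x)) @ 0^'+
    --> dot (grad x) (y - x).
  rewrite -gradientP -deriveE//.
  by apply: cvg_dnbhs_at_right; exact: diff_derivable.
rewrite -lerBrDl.
apply: (@ler_cvg_to _ _ _ _ _ (fun=> f y - f x) _ _ D); first exact: cvg_cst.
near=> t.
have t0 : 0 < t by near: t; exact: nbhs_right_gt.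
have t1 : t <= 1 by near: t; exact: nbhs_right_le.
rewrite /= /GRing.scale/= ler_pdivrMl//.
have -> : t *: (y - x) + x = t *: y + (1 - t) *: x.
  by rewrite scalerBr scalerBl scale1r -addrA (addrC (- _)).
by have := convex_functionE y x (ltW t0) t1; lra.
Unshelve. all: by end_near. Qed.

Variable beta : R.
Hypotheses (beta0 : 0 < beta) (grad_lip : (1 / beta).-lipschitz grad).

Lemma gradient_lipschitz x y : `|grad x - grad y| <= beta^-1 * `|x - y|.
Proof. by have := @grad_lip (x, y); rewrite /= div1r; apply. Qed.

Let dot_gradB x h : dot (grad (x + h) - grad x) h <= beta^-1 * `|h| ^+ 2.
Proof.
apply: le_trans (ler_norm _) _; apply: le_trans (dot_le_norm hdot _ _) _.
rewrite expr2 mulrA ler_wpM2r//; apply: le_trans (gradient_lipschitz _ _) _.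
by rewrite addrC addKr.
Qed.

Let descent_halving n x h :
  f (x + h) - f x - dot (grad x) h <=
  2^-1 * beta^-1 * (1 + 2^-1 ^+ n) * `|h| ^+ 2.
Proof.
elim: n x h => [|n IH] x h.
  have := gradient_ineq (x + h) x; have := dot_gradB x h.
  have -> : x - (x + h) = - h by rewrite opprD addrA subrr sub0r.
  have -> : 2^-1 / beta * (1 + 2^-1 ^+ 0) = beta^-1.
    by rewrite expr0; field; rewrite gt_eqF.
  move: (grad (x + h)) (grad x) (f (x + h)) (f x) (beta^-1 * _) => u v r s t.
  by rewrite !dotE; lra.
have [k kE] : exists k, k = 2^-1 *: h by exists (2^-1 *: h).
have hk : h = k + k.
  by rewrite kE -scalerDl (_ : 2^-1 + 2^-1 = 1 :> R) ?scale1r//; field.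
have nk : `|k| ^+ 2 = 4^-1 * `|h| ^+ 2.
  by rewrite -!(dotxx hdot) kE !dotE; field.
have := IH x k; have := IH (x + k) k; have := dot_gradB x k.
have -> : x + h = x + k + k by rewrite -addrA -hk.
have -> : dot (grad x) h = dot (grad x) k + dot (grad x) k.
  by rewrite -dotDr -hk.
rewrite nk (exprS 2^-1) dotDl dotNl.
move: (grad (x + k)) (grad x) (f (x + k)) (f x) => u v r s.
move: (f _) (2^-1 ^+ n) (`|h| ^+ 2) (beta^-1) => q e hh b; lra.
Qed.

(** With constant [1 / beta] the bound is immediate from convexity. Applying a
    bound with constant [c] on both halves of the step gives it with constant
    [c / 2 + 1 / (4 beta)], and iterating leads to the fixed point
    [1 / (2 beta)] of this recursion. *)
Lemma descent_lemma x h :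
  f (x + h) <= f x + dot (grad x) h + 2^-1 * beta^-1 * `|h| ^+ 2.
Proof.
suff : f (x + h) - f x - dot (grad x) h <= 2^-1 * beta^-1 * (1 + 0) * `|h| ^+ 2.
  lra.
have lim : 2^-1 * beta^-1 * (1 + 2^-1 ^+ n) * `|h| ^+ 2 @[n --> \oo] -->
    2^-1 * beta^-1 * (1 + 0) * `|h| ^+ 2.
  apply: cvgM; last exact: cvg_cst.
  apply: cvgM; first exact: cvg_cst.
  apply: cvgD; first exact: cvg_cst.
  by apply: cvg_expr; rewrite ger0_norm ?invr_ge0// invf_lt1// ltr1n.
apply: (ler_cvg_to (cvg_cst _) lim).
by apply: nearW => n; exact: descent_halving.
Qed.

(** Compare the lower bound at [x] and the upper bound at [y] in the point
    reached from [y] by a gradient step of length [beta] for [f - <grad x, .>]. *)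
Lemma baillon_haddad x y :
  f x + dot (grad x) (y - x) + 2^-1 * beta * `|grad y - grad x| ^+ 2 <= f y.
Proof.
have := gradient_ineq x (y - beta *: (grad y - grad x)).
have := descent_lemma y (- (beta *: (grad y - grad x))).
rewrite -!(dotxx hdot); move: (grad x) (grad y) (f _) (f x) (f y) => u v r s t.
have -> : y - beta *: (v - u) - x = (y - x) - beta *: (v - u) by rewrite addrAC.
have [w wE] : exists w, w = v - u by exists (v - u).
rewrite -wE; move: (y - x) => d.
have ww : dot w w = dot v w - dot u w by rewrite {1}wE !dotE.
rewrite !dotE.
have -> : 2^-1 / beta * - (- (beta * (beta * dot w w))) = 2^-1 * (beta * dot w w).
  by field; rewrite gt_eqF.
rewrite -mulrA ww; lra.
Qed.

Lemma gradient_cocoercive x y :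
  beta * `|grad x - grad y| ^+ 2 <= dot (grad x - grad y) (x - y).
Proof.
have := baillon_haddad x y; have := baillon_haddad y x.
move: (grad x) (grad y) (f x) (f y) => u v r s.
rewrite (distrC v u).
move: (`|u - v| ^+ 2) => n.
rewrite !dotE.
lra.
Qed.

End DifferentiableConvex.

(** * Subgradients *)

Section Subgradients.
Context {R : realType} {H : completeNormedModType R}.
Variable dot : {dot H for idfun}.
Hypothesis hdot : induces_norm dot.
Implicit Types (h g : H -> \bar R) (p q xi zeta : H).

Definition subgradient h p xi :=
  h p \is a fin_num /\ forall y, (h p + (dot xi (y - p))%:E <= h y)%E.

Lemma subgradient_monotone h p q xi zeta :
  subgradient h p xi -> subgradient h q zeta -> 0 <= dot (xi - zeta) (p - q).
Proof.
move=> [fp hp] [fq hq]; have := hp q; have := hq p.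
rewrite -(fineK fp) -(fineK fq) -!EFinD !lee_fin.
by move: (fine _) (fine _) => r s; rewrite !dotE; lra.
Qed.

Lemma subgradientZ h p xi (c : R) : 0 < c ->
  subgradient (fun y => c%:E * h y)%E p xi -> subgradient h p (c^-1 *: xi).
Proof.
move=> c0 [fp hp]; have fh : h p \is a fin_num.
  by move: fp; case: (h p) => [r||] //; rewrite (gt0_muley, gt0_muleNy)// lte_fin.
split=> // y; rewrite -(@lee_pmul2l _ c%:E)// ?lte_fin//.
apply: le_trans (hp y); move: fh; case: (h p) => [r|//|//] _.
by rewrite dotZl -EFinD -!EFinM -!EFinD lee_fin mulrDr mulVKf ?gt_eqF.
Qed.

Lemma ge0_of_affine_ge0 (a b : R) :
  (forall t, 0 < t -> t <= 1 -> 0 <= a + t * b) -> 0 <= a.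
Proof.
move=> hab; rewrite leNgt; apply/negP => a0.
have b0 := normr_ge0 b; have bb := ler_norm b.
have d0 : 0 < - a + `|b| + 1 by lra.
have t0 : 0 < - a / (- a + `|b| + 1) by rewrite divr_gt0// oppr_gt0.
have t1 : - a / (- a + `|b| + 1) <= 1 by rewrite ler_pdivrMr//; lra.
have := hab _ t0 t1.
have : - a / (- a + `|b| + 1) * b <= - a / (- a + `|b| + 1) * `|b|.
  by rewrite ler_wpM2l// ltW.
have : - a / (- a + `|b| + 1) * `|b| < - a.
  by rewrite mulrAC ltr_pdivrMr//; nra.
lra.
Qed.

(** Fermat's rule: [p] is compared with the points [p + t (y - p)], where the
    error of the linear model of [Q] is quadratic in [t] while convexity makes
    the variation of [h] linear in [t]. *)
Lemma argmin_subgradient (Q : H -> R) h p xi (C : R) :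
  convex_efun h -> proper_fun h ->
  (forall v, Q (p + v) <= Q p + dot xi v + C * `|v| ^+ 2) ->
  argmin (fun x => (Q x)%:E + h x)%E p -> subgradient h p (- xi).
Proof.
move=> hconv [hNy [x0 hx0]] hQ pmin.
have hfin x : (h x < +oo)%E -> h x = (fine (h x))%:E.
  by move=> hx; rewrite fineK// fin_numElt hNy hx.
have hp : h p = (fine (h p))%:E.
  apply: (hfin p); rewrite ltNge leye_eq; apply/negP => /eqP hpy.
  by have := pmin x0; rewrite hpy (hfin _ hx0) addey// leye_eq.
split; first by rewrite hp.
move=> y; have [hy|] := ltP (h y) +oo%E; last first.
  by rewrite leye_eq => /eqP ->; rewrite leey.
rewrite hp (hfin _ hy) -EFinD lee_fin -subr_ge0.
apply: (@ge0_of_affine_ge0 _ (C * `|y - p| ^+ 2)) => t t0 t1.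
have hconvt : (h (p + t *: (y - p))%R <=
    (t * fine (h y) + (1 - t) * fine (h p))%:E)%E.
  have -> : p + t *: (y - p) = t *: y + (1 - t) *: p.
    by rewrite scalerBr scalerBl scale1r addrCA.
  by rewrite EFinD !EFinM -hp -(hfin _ hy); exact: hconv (ltW t0) t1.
have hz := hfin _ (le_lt_trans hconvt (ltry _)).
have hmin := pmin (p + t *: (y - p)).
rewrite hz hp -!EFinD lee_fin in hmin; rewrite hz lee_fin in hconvt.
have := hQ (t *: (y - p)); move: hconvt hmin.
rewrite normrZ exprMn real_normK ?num_real// dotZr dotNl.
move: (Q _) (Q _) (fine _) (fine _) (fine _) (dot _ _) (`|_| ^+ 2).
move=> q r a b c d n h1 h2 h3.
rewrite -(@pmulr_rge0 _ t)//; lra.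
Qed.

Lemma subgradient_argmin (Q : H -> R) h p xi :
  (forall y, Q p + dot xi (y - p) <= Q y) -> subgradient h p (- xi) ->
  argmin (fun x => (Q x)%:E + h x)%E p.
Proof.
move=> hQ [fp hp] y /=; have := hp y; have := hQ y.
rewrite -(fineK fp); case: (h y) => [r|_ _|_ //]; last by rewrite addey// leey.
by rewrite -!EFinD !lee_fin (dotNl dot); lra.
Qed.

End Subgradients.

(** * Proximal maps *)

Section Prox.
Context {R : realType} {H : completeNormedModType R}.
Variable dot : {dot H for idfun}.
Hypothesis hdot : induces_norm dot.
Variables (W : {linear H -> H}) (c : R).
Hypotheses (Wc : continuous W) (Wsym : self_adjoint dot W) (c0 : 0 < c)
  (Wcoer : forall x, c * `|x| ^+ 2 <= dot (W x) x).
Variables (g : H -> \bar R) (q zeta : H).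
Hypotheses (g_proper : proper_fun g) (g_lsc : lower_semicontinuous g)
  (g_convex : convex_efun g) (hq : subgradient dot g q zeta).
Variable gamma : R.
Hypothesis gamma0 : 0 < gamma.

Local Notation h := (fun z => gamma%:E * g z)%E.

Let Wpsd x : 0 <= dot (W x) x.
Proof. by apply: le_trans (Wcoer x); rewrite mulr_ge0// ltW. Qed.

Let h_proper : proper_fun h.
Proof.
case: g_proper => gNy [x0 gx0]; split=> [x|].
  by move: (gNy x); case: (g x) => [r||] // _; rewrite ?gt0_muley ?lte_fin ?ltNyr.
exists x0; move: (gNy x0) gx0; case: (g x0) => [r||] // _ _; exact: ltry.
Qed.

Let h_lsc : lower_semicontinuous h.
Proof.
move=> x a; rewrite -lte_pdivrMl// => /(g_lsc (a := gamma^-1 * a)).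
by move=> [V Vx HV]; exists V => // y /HV; rewrite EFinM lte_pdivrMl.
Qed.

Let h_convex : convex_efun h.
Proof.
move=> t x y t0 t1; have t1' : 0 <= 1 - t by rewrite subr_ge0.
apply: le_trans (_ : gamma%:E * (t%:E * g x + (1 - t)%:E * g y) <= _)%E.
  by rewrite lee_pmul2l ?lte_fin// g_convex.
have NyM (r : R) z : 0 <= r -> (-oo < r%:E * g z)%E.
  rewrite le_eqVlt => /predU1P[<-|r0]; first by rewrite mul0e ltNy0.
  case: g_proper => /(_ z) + _; case: (g z) => [s _|_|//].
    by rewrite -EFinM ltNyr.
  by rewrite gt0_muley ?lte_fin.
rewrite muleDr//; last by rewrite ltninfty_adde_def// inE NyM.
by rewrite !muleA (muleC gamma%:E) (muleC gamma%:E).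
Qed.

(** The affine minorant provided by a subgradient, beaten at infinity by the
    quadratic term, bounds the objective from below. *)
Lemma prox_argmin x :
  argmin (fun y => (2^-1 * wnorm dot W (x - y) ^+ 2)%:E + h y)%E (prox dot W h x).
Proof.
have [p hp] : argmin (fun y => (2^-1 * wnorm dot W (x - y) ^+ 2)%:E + h y)%E !=set0.
  apply: (@strongly_convex_argmin _ _ _ _ (8^-1 * c)
    (gamma * (fine (g q) + dot zeta (x - q))
       - gamma ^+ 2 * `|zeta| ^+ 2 / (2 * c))) => //.
  - by rewrite mulr_gt0.
  - move=> y; under eq_fun do rewrite sqr_wnorm//.
    apply: cvgM; first exact: cvg_cst.
    have cB : x - z @[z --> y] --> x - y by apply: cvgB; [exact: cvg_cst|exact: cvg_id].
    apply: (cvg_dot hdot) => //; apply: (cvg_comp _ _ cB); exact: Wc.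
  - move=> y z; rewrite !sqr_wnorm//.
    have := coercive_midpoint Wsym Wcoer (x - y) (x - z).
    have -> : 2^-1 *: (x - y + (x - z)) = x - 2^-1 *: (y + z).
      rewrite addrACA -opprD scalerBr -{1 2}(scale1r x) -scalerDl scalerA.
      by rewrite (_ : 2^-1 * (1 + 1) = 1 :> R) ?scale1r//; field.
    have -> : x - y - (x - z) = z - y by rewrite opprB addrC addrA subrK.
    by rewrite (distrC z y); lra.
  - move=> y; rewrite sqr_wnorm//.
    case: hq => fq /(_ y); rewrite -{1}(fineK fq) => gy.
    apply: le_trans (_ : (2^-1 * dot (W (x - y)) (x - y) +
        gamma * (fine (g q) + dot zeta (y - q)))%:E <= _)%E; last first.
      by rewrite EFinD leeD2l// EFinM lee_pmul2l ?lte_fin// EFinD.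
    rewrite lee_fin.
    have := Wcoer (x - y); have := dot_le_norm hdot zeta (x - y).
    have -> : dot zeta (y - q) = dot zeta (x - q) - dot zeta (x - y).
      by rewrite !dotE; lra.
    move: (dot (W _) _) (dot zeta (x - q)) (dot zeta (x - y)) (fine _) => w a b s hb hw.
    have : 0 <= (c * `|x - y| - gamma * `|zeta|) ^+ 2 / (2 * c).
      by rewrite divr_ge0 ?sqr_ge0// mulr_ge0// ltW.
    have -> : (c * `|x - y| - gamma * `|zeta|) ^+ 2 / (2 * c) =
       2^-1 * (c * `|x - y| ^+ 2) - gamma * (`|zeta| * `|x - y|) +
       gamma ^+ 2 * `|zeta| ^+ 2 / (2 * c) by field; rewrite gt_eqF.
    have : gamma * b <= gamma * (`|zeta| * `|x - y|).
      by rewrite ler_wpM2l ?(ltW gamma0)//; exact: le_trans (ler_norm _) hb.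
    by move: (_ / (2 * c)) => k; lra.
exact: (@getPex _ (argmin (fun y => (2^-1 * wnorm dot W (x - y) ^+ 2)%:E + h y)%E)
  (ex_intro _ p hp)).
Qed.

Lemma prox_subgradient x :
  subgradient dot g (prox dot W h x) (gamma^-1 *: W (x - prox dot W h x)).
Proof.
have := prox_argmin x; move: (prox dot W h x) => p pmin.
apply: subgradientZ => //.
have [M M0 WM] := bounded_op_le (proj2 (linear_bounded_continuous W) Wc).
rewrite -[W _]opprK.
apply: (argmin_subgradient h_convex h_proper (C := 2^-1 * M) _ pmin) => v.
rewrite !sqr_wnorm// opprD addrA; move: (x - p) => e.
rewrite (linearB W) !(dotDl, dotDr, dotNl, dotNr).
rewrite (Wsym v e) (dotC dot v (W e)).
have : dot (W v) v <= M * `|v| ^+ 2.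
  apply: le_trans (ler_norm _) _; apply: le_trans (dot_le_norm hdot _ _) _.
  by rewrite expr2 mulrA ler_wpM2r.
lra.
Qed.

(** Monotonicity of the subdifferential at the two proximal points gives firm
    nonexpansiveness in the metric [W]. *)
Lemma wnorm_prox_le x y :
  wnorm dot W (prox dot W h x - prox dot W h y) <= wnorm dot W (x - y).
Proof.
have := subgradient_monotone (prox_subgradient x) (prox_subgradient y).
move: (prox dot W h x) (prox dot W h y) => p r.
rewrite -scalerBr dotZl pmulr_rge0 ?invr_gt0// -(linearB W).
have -> : x - p - (y - r) = (x - y) - (p - r).
  by rewrite !opprB (addrC r (- y)) addrACA (addrC (- p)).
rewrite (linearB W) dotDl dotNl subr_ge0 => hle.
have := dot_le_wnorm Wsym Wpsd (x - y) (p - r).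
rewrite -(sqr_wnorm Wpsd) in hle; move/(le_trans hle).
have := wnorm_ge0 dot W (p - r); rewrite le_eqVlt => /predU1P[<- _|r0].
  exact: wnorm_ge0.
by rewrite expr2 ler_pM2r.
Qed.

End Prox.

(** * Weak limits along ultrafilters *)

Lemma cvg_finer_filter (T : Type) (V : topologicalType) (F G : set_system T)
    (u : T -> V) (l : V) : F `<=` G -> u @ F --> l -> u @ G --> l.
Proof. by move=> FG ul; apply: cvg_trans ul; move=> A; exact: FG. Qed.

Section WeakCompactness.
Context {R : realType} {H : completeNormedModType R}.
Variable dot : {dot H for idfun}.
Hypothesis hdot : induces_norm dot.

Lemma cvg_dot_strong_weak (T : Type) (F : set_system T) (FF : Filter F)
    (u v : T -> H) (M : R) ul vl :
  u @ F --> ul -> (forall i, `|v i| <= M) ->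
  (forall h, dot (v i) h @[i --> F] --> dot vl h) ->
  dot (u i) (v i) @[i --> F] --> dot ul vl.
Proof.
move=> uul vM vw.
have -> : (fun i => dot (u i) (v i)) =
    (fun i => dot (u i - ul) (v i) + dot (v i) ul).
  by apply/funext => i; rewrite !dotE (dotC dot (v i)) subrK.
have -> : dot ul vl = 0 + dot vl ul by rewrite add0r dotC.
have u0 : u i - ul @[i --> F] --> (0 : H).
  by rewrite -(subrr ul); apply: cvgB => //; exact: cvg_cst.
apply: cvgD; last exact: vw.
exact: (@cvg_dot_bounded0 _ _ _ hdot T F FF (fun i => u i - ul) v M).
Qed.

Lemma ultra_bounded_cvg (T : Type) (F : set_system T) (UF : UltraFilter F)
    (u : T -> R) (M : R) :
  (forall i, `|u i| <= M) -> exists l : R, u @ F --> l.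
Proof.
move=> uM; have FF : ProperFilter F by exact: ultra_proper.
have uFI : (u @ F) `[- M, M]%classic.
  have uM' : \forall i \near F, `[- M, M]%classic (u i).
    by apply: nearW => i /=; rewrite in_itv/= -ler_norml.
  exact: uM'.
have [l [_ clul]] := @segment_compact R (- M) M (u @ F) _ uFI.
exists l; apply/cvgrPdist_lt => e e0.
have [//|FnA] := in_ultra_setVsetC [set i | `|l - u i| < e] UF.
have FnB : (u @ F) [set r | ~ `|l - r| < e] by [].
have [r [rnA rA]] := clul _ _ FnB (nbhsx_ballx l e e0).
by exfalso; apply: rnA; rewrite -ball_normE in rA.
Qed.

Section UltraLimit.
Variables (T : topologicalType) (F : set_system T) (x : T -> H) (M : R).
Hypotheses (UF : UltraFilter F) (xM : forall i, `|x i| <= M).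

(** Limits along an ultrafilter always exist for bounded real functions, so
    they define a bounded linear form at once, without extracting
    subsequences; its Riesz representative is the weak limit. *)
Lemma weak_ultra_limit :
  exists p, forall h, dot (x i) h @[i --> F] --> dot p h.
Proof.
have FF : ProperFilter F by exact: ultra_proper.
have exL h : exists l : R, dot (x i) h @[i --> F] --> l.
  apply: (@ultra_bounded_cvg _ _ UF _ (M * `|h|)) => i.
  by apply: le_trans (dot_le_norm hdot _ _) _; rewrite ler_wpM2r.
have [L HL] := choice exL.
have Llin : linear (L : H -> R^o).
  move=> t u v; have : dot (x i) (t *: u + v) @[i --> F] --> t * L u + L v.
    under eq_fun do rewrite dotDr dotZr.
    by apply: cvgD => //; apply: cvgM => //; exact: cvg_cst.
  by apply: (@cvg_unique R^o _ _ _ _ _ (HL _)).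
have LM h : `|L h| <= M * `|h|.
  have Hn : `|dot (x i) h| @[i --> F] --> `|L h| by apply: cvg_norm; exact: HL.
  have Mh : M * `|h| @[_ --> F] --> M * `|h| by exact: cvg_cst.
  apply: (ler_cvg_to Hn Mh); near=> i.
  by apply: le_trans (dot_le_norm hdot _ _) _; rewrite ler_wpM2r.
pose L' : {linear H -> R^o} := HB.pack L (GRing.isLinear.Build _ _ _ _ _ Llin).
have Lc : continuous L'.
  apply: bounded_linear_continuous; apply/bounded_funP => r.
  exists (`|M| * r) => h hr; apply: le_trans (LM h) _.
  by apply: le_trans (_ : `|M| * `|h| <= _); rewrite (ler_wpM2r, ler_wpM2l)// ler_norm.
have [p Hp] := riesz hdot Lc.
by exists p => h; rewrite -Hp; exact: HL.
Unshelve. all: by end_near. Qed.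

End UltraLimit.

(** If convergence fails against some [h], the indices with a large gap form a
    set compatible with [\oo]; an ultrafilter containing both has a weak limit
    which the gap keeps away from [p]. *)
Lemma weakly_cvg_unique_limit (x : nat -> H) (M : R) (p : H) :
  (forall k, `|x k| <= M) ->
  (forall F q, UltraFilter F -> \oo `<=` F ->
    (forall h, dot (x k) h @[k --> F] --> dot q h) -> q = p) ->
  weakly_cvg dot x p.
Proof.
move=> xM uniq h; apply/cvgrPdist_lt => e e0; apply: contrapT => far.
pose B := [set k | ~ `|dot p h - dot (x k) h| < e].
have PB : ProperFilter (within B \oo).
  split; last exact: within_filter.
  move=> W; have W' : \forall k \near \oo, B k -> False by exact: W.
  by apply: far; near=> k; apply: contrapT; near: k; exact: W'.
have [F [UF BF]] := ultraFilterLemma PB.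
have FF : ProperFilter F by exact: ultra_proper.
have ooF : \oo `<=` F by move=> A Aoo; apply: BF; exact: filterS Aoo.
have FB : F B by apply: BF; exact: withinT.
have [q Hq] := weak_ultra_limit UF xM.
have qp := uniq F q UF ooF Hq; subst q.
have /cvgrPdist_lt/(_ _ e0) near_p := Hq h.
by have [k []] := filter_ex (filterI near_p FB).
Unshelve. all: by end_near. Qed.

End WeakCompactness.

(** * Variable metrics and the forward-backward inequality *)

Section MonotoneMetrics.
Context {R : realType} {H : completeNormedModType R}.
Variable dot : {dot H for idfun}.
Hypothesis hdot : induces_norm dot.
Variables (W : nat -> {linear H -> H}) (C : R) (eta : nat -> R).
Hypotheses (Wsym : forall k, self_adjoint dot (W k))
  (Wpsd : forall k x, 0 <= dot (W k x) x)
  (C0 : 0 < C) (Wle : forall k x, dot (W k x) x <= C * `|x| ^+ 2)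
  (eta0 : forall k, 0 <= eta k) (eta_sum : bounded_sums eta)
  (Wmono : forall k x, dot (W k.+1 x) x <= (1 + eta k) * dot (W k x) x).

Let P n := \prod_(0 <= k < n) (1 + eta k).

Let P0 n : 0 < P n. Proof. exact: prod1D_gt0. Qed.

(** After normalisation by the partial products of [1 + eta] the forms
    decrease, and a decreasing sequence of positive operators converges
    strongly since the quadratic form of a positive operator controls its norm. *)
Lemma monotone_metrics_cvg x : cvgn (fun k => W k x).
Proof.
pose v k := (P k)^-1 * dot (W k x) x.
have vnonincr y : nonincreasing_seq (fun k => (P k)^-1 * dot (W k y) y).
  apply/nonincreasing_seqP => n; rewrite ler_pdivrMl//.
  apply: le_trans (Wmono n y) _.
  by rewrite /P big_nat_recr//= -/(P n) mulrA (mulrC (P n)) mulfK ?gt_eqF.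
have vcvg : cvgn v.
  apply: nonincreasing_is_cvgn; first exact: vnonincr.
  by exists 0 => _ [n _ <-]; rewrite mulr_ge0// invr_ge0 ltW.
have vge n : limn v <= v n by apply: nonincreasing_cvgn_ge vcvg n; exact: vnonincr.
have diff m n : (m <= n)%N ->
    `|(P m)^-1 *: W m x - (P n)^-1 *: W n x| ^+ 2 <= C * (v m - v n).
  move=> mn.
  pose D : {linear H -> H} := ((P m)^-1 \*: W m) \- ((P n)^-1 \*: W n).
  have DE y z : dot (D y) z = (P m)^-1 * dot (W m y) z - (P n)^-1 * dot (W n y) z.
    by rewrite /D/= !dotE.
  have Dsym : self_adjoint dot D.
    by move=> y z; rewrite (dotC dot y) !DE !(Wsym _ y) !(dotC dot y).
  have Dpsd y : 0 <= dot (D y) y by rewrite DE subr_ge0; exact: vnonincr.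
  have DC y : dot (D y) y <= C * `|y| ^+ 2.
    rewrite DE; apply: le_trans (_ : (P m)^-1 * dot (W m y) y <= _).
      by rewrite gerBl mulr_ge0// invr_ge0 ltW.
    apply: le_trans (Wle m y).
    by rewrite ler_piMl// invf_le1// prod1D_ge1.
  have := psd_sqr_norm_le hdot Dsym Dpsd x DC; rewrite DE; exact.
have cau : cvgn (fun k => (P k)^-1 *: W k x).
  apply/cauchy_cvgP; apply: cauchy_exP => e e0.
  have Ce : 0 < e ^+ 2 / C by rewrite divr_gt0// exprn_gt0.
  have /cvgrPdist_lt/(_ _ Ce)[N _ HN] : v n @[n --> \oo] --> limn v by exact: vcvg.
  exists ((P N)^-1 *: W N x); exists N => // n /= Nn; rewrite -ball_normE/=.
  rewrite -(@ltr_pXn2r _ 2)// ?nnegrE ?(ltW e0)//.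
  apply: le_lt_trans (diff N n Nn) _; rewrite mulrC -ltr_pdivlMr//.
  have := HN N (leqnn N); rewrite /= distrC ger0_norm ?subr_ge0//.
  by have := vge n; lra.
have -> : (fun k => W k x) = (fun k => P k *: ((P k)^-1 *: W k x)).
  by apply/funext => k; rewrite scalerA divff ?gt_eqF// scale1r.
have Pcvg : cvgn P by exact: prod1D_cvg.
by apply: cvgP; apply: cvgZ Pcvg cau.
Qed.

End MonotoneMetrics.

Section OneStep.
Context {R : realType} {H : completeNormedModType R}.
Variable dot : {dot H for idfun}.
Hypothesis hdot : induces_norm dot.
Variables (W : {linear H -> H}) (N beta gamma : R) (d u z : H).
Hypotheses (Wsym : self_adjoint dot W) (Wpsd : forall x, 0 <= dot (W x) x).
Hypotheses (beta0 : 0 < beta) (gamma0 : 0 < gamma).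
Hypothesis NW : forall x, `|x| ^+ 2 <= N * dot (W x) x.
Hypothesis monotone : 0 <= dot (W d - gamma *: u) (z - d).
Hypothesis cocoercive : beta * `|u| ^+ 2 <= dot u z.

Let v := u - (2 * beta)^-1 *: d.

(** The four last terms are nonnegative: they measure how far the monotonicity
    of the subdifferential of [g], the cocoercivity of the gradient of [f],
    Young's inequality and [|d|^2 <= N <W d, d>] are from equalities. Dropping
    them gives the averagedness of the forward-backward operator. *)
Lemma dot_step_eq :
  dot (W d) z = (1 - gamma * N / (4 * beta)) * dot (W d) d
    + dot (W d - gamma *: u) (z - d) + gamma * (dot u z - beta * `|u| ^+ 2)
    + gamma * beta * `|v| ^+ 2
    + gamma / (4 * beta) * (N * dot (W d) d - `|d| ^+ 2).
Proof.
rewrite -!(dotxx hdot) /v !dotE (dotC dot d u).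
by field; rewrite gt_eqF.
Qed.


(** The left-hand side of the last hypothesis is the decrease of the squared
    distance over one relaxed step, so a small decrease forces every
    inequality behind the averagedness to be almost an equality. *)
Lemma step_slack (lambda lmin gmin delta : R) :
  0 < lmin -> lmin <= lambda -> lambda <= (4 * beta - gamma * N) / (2 * beta) ->
  0 < gmin -> gmin <= gamma ->
  2 * lambda * dot (W d) z - lambda ^+ 2 * dot (W d) d <= 2 * lmin * gmin * delta ->
  [/\ dot u z - beta * `|u| ^+ 2 <= delta, beta * `|v| ^+ 2 <= delta &
      N * dot (W d) d - `|d| ^+ 2 <= 4 * beta * delta].
Proof.
move=> l0 ll lU g0 gg.
have lam0 : 0 < lambda by exact: lt_le_trans ll.
rewrite dot_step_eq.
have := monotone; have := cocoercive; have := NW d; have := Wpsd d.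
have bv0 : 0 <= beta * `|v| ^+ 2 by rewrite mulr_ge0// ?ltW// sqr_ge0.
move: bv0; have -> : gamma * beta * `|v| ^+ 2 = gamma * (beta * `|v| ^+ 2).
  by rewrite mulrA.
move: (dot (W d - _) _) (beta * `|v| ^+ 2) (dot (W d) d) (`|d| ^+ 2) (dot u z).
move: (beta * `|u| ^+ 2) => bu s1 bv w dd uz bv0 w0 hA hc hm hD.
have A0 : 0 <= (N * w - dd) / (4 * beta).
  by rewrite divr_ge0 ?subr_ge0// mulr_ge0// ltW.
pose S := (uz - bu) + bv + (N * w - dd) / (4 * beta).
have S0 : 0 <= S by rewrite /S; lra.
have hlam : 0 <= lambda * ((4 * beta - gamma * N) / (2 * beta) - lambda) * w.
  by rewrite mulr_ge0// mulr_ge0 ?subr_ge0// ltW.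
have hS : lambda * gamma * S <= lmin * gmin * delta.
  have e : 2 * lambda * ((1 - gamma * N / (4 * beta)) * w + s1 +
      gamma * (uz - bu) + gamma * bv + gamma / (4 * beta) * (N * w - dd)) -
      lambda ^+ 2 * w =
      lambda * ((4 * beta - gamma * N) / (2 * beta) - lambda) * w +
      2 * (lambda * s1) + 2 * (lambda * gamma * S).
    by rewrite /S; field; rewrite gt_eqF.
  have ls1 : 0 <= lambda * s1 by rewrite mulr_ge0// ltW.
  by move: hD; rewrite e; lra.
have Sd : S <= delta.
  rewrite -(ler_pM2l (mulr_gt0 l0 g0)); apply: le_trans hS.
  by rewrite ler_wpM2r// ler_pM// ltW.
have hA4 : (N * w - dd) = 4 * beta * ((N * w - dd) / (4 * beta)).
  by field; rewrite gt_eqF.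
split; [by move: Sd; rewrite /S; lra|by move: Sd; rewrite /S; lra|].
rewrite hA4 ler_wpM2l//; first by rewrite mulr_ge0// ltW.
by move: Sd; rewrite /S; lra.
Qed.

Lemma step_wnorm_le (kappa : R) :
  kappa <= (4 * beta - gamma * N) / (2 * beta) - 1 ->
  2^-1 * (1 + kappa) * dot (W d) d <= dot (W d) z.
Proof.
move=> hk.
rewrite dot_step_eq.
have := monotone; have := cocoercive; have := NW d; have := Wpsd d.
have bv0 : 0 <= gamma * beta * `|v| ^+ 2.
  by rewrite mulr_ge0 ?sqr_ge0// mulr_ge0// ltW.
move=> w0 h1 h2 h3.
have h4 : 0 <= gamma / (4 * beta) * (N * dot (W d) d - `|d| ^+ 2).
  by rewrite mulr_ge0 ?subr_ge0// divr_ge0 ?mulr_ge0 ?ltW.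
have h5 : 0 <= gamma * (dot u z - beta * `|u| ^+ 2).
  by rewrite mulr_ge0 ?subr_ge0// ltW.
have h6 : 2^-1 * (1 + kappa) * dot (W d) d <=
    (1 - gamma * N / (4 * beta)) * dot (W d) d.
  rewrite ler_wpM2r//.
  have -> : 1 - gamma * N / (4 * beta) =
      2^-1 * ((4 * beta - gamma * N) / (2 * beta)).
    by field; rewrite gt_eqF.
  by rewrite ler_wpM2l//; lra.
lra.
Qed.

(** When the slacks vanish, [d] is an eigenvector of [W] for [1 / N] and
    [u = d / (2 beta)], so that [<W d, z>] equals [|d|^2 / (2 N)]; but it is
    also at least [(2 - gamma N / (2 beta)) |d|^2 / (2 N)], which is larger
    unless [d = 0]. The lemma is the quantitative form of this remark. *)
Lemma step_bound (kappa : R) : 0 <= N ->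
  kappa <= (4 * beta - gamma * N) / (2 * beta) - 1 -> 0 <= kappa ->
  2^-1 * kappa * `|d| ^+ 2 <=
    2 * beta * (dot u z - beta * `|u| ^+ 2) + 2 * beta * (`|v| * (`|d| + `|z|))
    + 2 * beta * (beta * `|v| ^+ 2)
    + Num.sqrt (N * dot (W d) d - `|d| ^+ 2) * Num.sqrt (N * dot (W z) z - `|z| ^+ 2).
Proof.
move=> N0 hk k0.
pose A : {linear H -> H} := (N \*: W) \- idfun.
have AE x y : dot (A x) y = N * dot (W x) y - dot x y by rewrite /A/= !dotE.
have Asym : self_adjoint dot A.
  by move=> x y; rewrite (dotC dot x) !AE (Wsym x) !(dotC dot x).
have Apsd x : 0 <= dot (A x) x by rewrite AE (dotxx hdot) subr_ge0.
have := dot_le_wnorm Asym Apsd d z; rewrite /wnorm !AE !(dotxx hdot).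
set q := Num.sqrt _ * _ => hq.
have hNW : 2^-1 * (1 + kappa) * `|d| ^+ 2 <= N * dot (W d) z.
  apply: le_trans (_ : N * (2^-1 * (1 + kappa) * dot (W d) d) <= _).
    rewrite (mulrCA N) ler_wpM2l ?NW// mulr_ge0//; lra.
  by rewrite ler_wpM2l// step_wnorm_le.
have hdz : dot d z = 2 * beta * (dot u z - beta * `|u| ^+ 2)
    + 2 * beta * dot v (d - z) + 2 * beta * (beta * `|v| ^+ 2) + 2^-1 * `|d| ^+ 2.
  rewrite -!(dotxx hdot) /v !dotE (dotC dot d u).
  by field; rewrite gt_eqF.
have hv : 2 * beta * dot v (d - z) <= 2 * beta * (`|v| * (`|d| + `|z|)).
  rewrite ler_wpM2l//; first by rewrite mulr_ge0// ltW.
  apply: le_trans (ler_norm _) _.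
  apply: le_trans (dot_le_norm hdot _ _) _.
  by rewrite ler_wpM2l// ler_normB.
lra.
Qed.

End OneStep.

(** * Convergence of the forward-backward iteration *)

Section ForwardBackward.
Context {R : realType} {H : completeNormedModType R}.
Variable dot : {dot H for idfun}.
Hypothesis hdot : induces_norm dot.

Variables (g : H -> \bar R) (f : H -> R) (beta : R).
Hypotheses (g_proper : proper_fun g) (g_lsc : lower_semicontinuous g)
  (g_convex : convex_efun g).
Hypotheses (f_convex : convex_function [set: H] f)
  (f_diff : forall x : H, differentiable f x)
  (beta0 : 0 < beta) (grad_lip : (1 / beta).-lipschitz (gradient dot f)).
Local Notation grad := (gradient dot f).
Local Notation Omega := (argmin (fun x => (f x)%:E + g x)%E).
Variable xs0 : H.
Hypothesis Omega_xs0 : Omega xs0.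

Lemma argmin_sum_subgradient xs : Omega xs -> subgradient dot g xs (- grad xs).
Proof.
apply: argmin_subgradient => // v.
exact: (descent_lemma hdot f_convex f_diff beta0 grad_lip).
Qed.

Lemma subgradient_argmin_sum xs : subgradient dot g xs (- grad xs) -> Omega xs.
Proof.
apply: subgradient_argmin => y.
exact: (gradient_ineq hdot f_convex f_diff).
Qed.

(** Monotonicity of the subdifferential of [g] and cocoercivity of the gradient
    of [f] pull in opposite directions. *)
Lemma gradient_argmin_unique xs ys : Omega xs -> Omega ys -> grad xs = grad ys.
Proof.
move=> /argmin_sum_subgradient hx /argmin_sum_subgradient hy.
have := subgradient_monotone hx hy.
have := gradient_cocoercive hdot f_convex f_diff beta0 grad_lip xs ys.
move: (grad xs) (grad ys) => u v h1.
have -> : - u - - v = - (u - v) by rewrite opprB opprK addrC.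
rewrite dotNl oppr_ge0 => h2.
have : beta * `|u - v| ^+ 2 <= 0 by exact: le_trans h2.
rewrite pmulr_rle0// => h3; apply/eqP; rewrite -subr_eq0 -normr_eq0 -sqrf_eq0.
by rewrite eq_le h3 sqr_ge0.
Qed.

(** Minty's trick: the graph of a maximal monotone operator is closed for the
    weak-strong topology. Maximality enters through the point
    [prox (p + xi)], at which the resolvent equation provides a subgradient. *)
Lemma subgradient_weak_closed (F : set_system nat) (FF : ProperFilter F)
    (p_ xi_ : nat -> H) (M : R) p xi :
  (forall k, `|p_ k| <= M) ->
  (forall k, subgradient dot g (p_ k) (xi_ k)) ->
  (forall h, dot (p_ k) h @[k --> F] --> dot p h) ->
  xi_ k @[k --> F] --> xi ->
  subgradient dot g p xi.
Proof.
move=> pM hsub pw xis.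
have idc : continuous (idfun : {linear H -> H}) by move=> z; exact: cvg_id.
have ids : self_adjoint dot (idfun : {linear H -> H}) by [].
have idp z : 1 * `|z| ^+ 2 <= dot ((idfun : {linear H -> H}) z) z.
  by rewrite mul1r (dotxx hdot).
have := prox_subgradient hdot idc ids ltr01 idp g_proper g_lsc g_convex
  (argmin_sum_subgradient Omega_xs0) ltr01 (p + xi).
rewrite invr1 scale1r /=; set q := prox _ _ _ _ => hq.
have ge0 : 0 <= dot (xi - (p + xi - q)) (p - q).
  have lim : dot (xi_ k - (p + xi - q)) (p_ k - q) @[k --> F] -->
      dot (xi - (p + xi - q)) (p - q).
    apply: (@cvg_dot_strong_weak _ _ _ hdot _ F _ _ _ (M + `|q|)).
    - by apply: cvgB => //; exact: cvg_cst.
    - by move=> k; rewrite (le_trans (ler_normB _ _))// lerD2r.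
    - move=> h; under eq_fun do rewrite dotDl.
      by rewrite dotDl; apply: cvgD; [exact: pw|exact: cvg_cst].
  apply: (cvgr_to_ge lim); near=> k.
  exact: subgradient_monotone (hsub k) hq.
have pq : p = q.
  apply/eqP; rewrite -subr_eq0 -normr_eq0 -sqrf_eq0 -(dotxx hdot).
  rewrite eq_le (dot_ge0 dot) andbT -oppr_ge0 -dotNl.
  have -> : - (p - q) = xi - (p + xi - q).
    by rewrite opprD opprK opprD opprK opprD addrA addrCA subrr addr0.
  exact: ge0.
by move: hq; rewrite -pq (addrC p) addrK.
Unshelve. all: by end_near. Qed.

Section Iteration.
Variables (alpha mu : R) (U W : nat -> {linear H -> H}).
Variables (eta gamma lambda : nat -> R) (a b x p d : nat -> H).
Variables (lmin gmin gmax kappa : R).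
Local Notation N k := (opnorm (U k)).
Hypotheses (alpha0 : 0 < alpha) (mu0 : 0 < mu)
  (Upos : forall k, strongly_positive_ops dot alpha (U k))
  (WK : forall k, cancel (W k) (U k)) (UK : forall k, cancel (U k) (W k))
  (N_le : forall k, N k <= mu)
  (Umono : forall k, loewner_ge dot (fun x => (1 + eta k) *: U k.+1 x) (U k))
  (eta0 : forall k, 0 <= eta k) (eta_sum : bounded_sums eta).
Hypotheses (gmin0 : 0 < gmin) (gmin_le : forall k, gmin <= gamma k)
  (gmax_ge : forall k, gamma k <= gmax)
  (kappa0 : 0 < kappa)
  (kappa_le : forall k,
    kappa <= (4 * beta - gamma k * N k) / (2 * beta) - 1)
  (lmin0 : 0 < lmin) (lmin_le : forall k, lmin <= lambda k)
  (lambda_le : forall k, lambda k <= (4 * beta - gamma k * N k) / (2 * beta)).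
Hypotheses (a_sum : bounded_sums (fun k => lambda k * `|a k|))
  (b_sum : bounded_sums (fun k => lambda k * `|b k|)).
Local Notation prox_ k := (prox dot (W k) (fun z => (gamma k)%:E * g z)%E).
Hypotheses
  (xE : forall k, x k.+1 = x k + lambda k *:
    (prox_ k (x k - gamma k *: U k (grad (x k) + b k)) + a k - x k))
  (pE : forall k, p k = prox_ k (x k - gamma k *: U k (grad (x k))))
  (dE : forall k, d k = x k - p k).

Let gamma0 k : 0 < gamma k. Proof. exact: lt_le_trans (gmin_le k). Qed.

Let lambda0 k : 0 < lambda k. Proof. exact: lt_le_trans (lmin_le k). Qed.

Let Wsym k : self_adjoint dot (W k).
Proof. exact: (opinv_self_adjoint (Upos k) (WK k)). Qed.

Let Wpsd k v : 0 <= dot (W k v) v.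
Proof. exact: (opinv_psd hdot alpha0 (Upos k) (WK k)). Qed.

Let Wcont k : continuous (W k).
Proof. exact: (opinv_continuous hdot alpha0 (Upos k) (WK k)). Qed.

Let Wle k v : dot (W k v) v <= alpha^-1 * `|v| ^+ 2.
Proof. exact: (opinv_dot_le hdot alpha0 (Upos k) (WK k)). Qed.

Let NW k v : `|v| ^+ 2 <= N k * dot (W k v) v.
Proof. exact: (sqr_norm_le_opinv hdot alpha0 (Upos k) (WK k)). Qed.

Let muW k v : `|v| ^+ 2 <= mu * dot (W k v) v.
Proof. by apply: le_trans (NW k v) _; rewrite ler_wpM2r. Qed.

Let Wcoer k v : mu^-1 * `|v| ^+ 2 <= dot (W k v) v.
Proof. by rewrite ler_pdivrMl// muW. Qed.

Let Wmono k v : dot (W k.+1 v) v <= (1 + eta k) * dot (W k v) v.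
Proof.
case: (Upos k) => _ Usym _.
have Upsd w : 0 <= dot (U k w) w.
  apply: le_trans (strongly_positiveP hdot (Upos k) w).
  by rewrite mulr_ge0// ltW.
have eta1 : 0 < 1 + eta k by rewrite ltr_pwDl.
exact: (loewner_ge_inv Usym Upsd (WK k) (WK k.+1) eta1 (Umono k)).
Qed.

Let sub0 := argmin_sum_subgradient Omega_xs0.

Lemma iter_subgradient k :
  subgradient dot g (p k) ((gamma k)^-1 *: W k (d k) - grad (x k)).
Proof.
have mu'0 : 0 < mu^-1 by rewrite invr_gt0.
have := prox_subgradient hdot (@Wcont k) (@Wsym k) mu'0 (Wcoer k) g_proper
  g_lsc g_convex sub0 (gamma0 k) (x k - gamma k *: U k (grad (x k))).
rewrite -pE addrAC -dE (linearB (W k)) (linearZ_LR (W k))/= UK.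
by rewrite scalerBr scalerA mulVf ?gt_eqF// scale1r.
Qed.

Lemma iter_monotone xs k : Omega xs ->
  0 <= dot (W k (d k) - gamma k *: (grad (x k) - grad xs)) (x k - xs - d k).
Proof.
move=> /argmin_sum_subgradient hxs.
have := subgradient_monotone (iter_subgradient k) hxs.
have -> : x k - xs - d k = p k - xs by rewrite addrAC dE subKr.
have -> : (gamma k)^-1 *: W k (d k) - grad (x k) - - grad xs =
    (gamma k)^-1 *: (W k (d k) - gamma k *: (grad (x k) - grad xs)).
  rewrite scalerBr scalerA mulVf ?gt_eqF// scale1r.
  by rewrite opprB opprK -addrA (addrC (grad xs)).
by rewrite dotZl pmulr_rge0 ?invr_gt0.
Qed.

Lemma iter_cocoercive xs k :
  beta * `|grad (x k) - grad xs| ^+ 2 <= dot (grad (x k) - grad xs) (x k - xs).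
Proof. exact: (gradient_cocoercive hdot f_convex f_diff beta0 grad_lip). Qed.

(* The error [b k] reaches the iterate through the proximal map, which is
   nonexpansive in the metric [W k], and there [U k (b k)] has size at most
   [sqrt mu |b k|]. *)
Let err k := lambda k * (gmax * Num.sqrt mu * `|b k| + Num.sqrt alpha^-1 * `|a k|).

Let gmax0 : 0 <= gmax. Proof. exact: le_trans (ltW (gamma0 0)) (gmax_ge 0). Qed.

Let err0 k : 0 <= err k.
Proof.
rewrite mulr_ge0 ?(ltW (lambda0 k))// addr_ge0// mulr_ge0// ?sqrtr_ge0//.
by rewrite mulr_ge0// sqrtr_ge0.
Qed.

Let err_sum : bounded_sums err.
Proof.
have h1 : 0 <= gmax * Num.sqrt mu by rewrite mulr_ge0// sqrtr_ge0.
have := bounded_sumsD (bounded_sumsZ h1 b_sum)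
  (bounded_sumsZ (sqrtr_ge0 alpha^-1) a_sum).
apply: bounded_sums_le => k.
by rewrite /err mulrDr (mulrCA (lambda k)) (mulrCA (lambda k)).
Qed.

Let wnorm_le k v : wnorm dot (W k) v <= Num.sqrt alpha^-1 * `|v|.
Proof.
rewrite -[`|v|]ger0_norm// -sqrtr_sqr -sqrtrM ?invr_ge0 ?(ltW alpha0)//.
exact: ler_wsqrtr.
Qed.

Let wnorm_U_le k v : wnorm dot (W k) (U k v) <= Num.sqrt mu * `|v|.
Proof.
rewrite -[`|v|]ger0_norm// -sqrtr_sqr -sqrtrM ?(ltW mu0)//.
apply: ler_wsqrtr; rewrite UK dotC.
case: (Upos k) => Ubnd _ _; apply: le_trans (dot_op_le hdot Ubnd v) _.
by rewrite ler_wpM2r.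
Qed.

Let n xs k := wnorm dot (W k) (x k - xs).
Let m xs k := wnorm dot (W k) (x k - xs - lambda k *: d k).

Let iter_error k : exists2 e, wnorm dot (W k) (lambda k *: e) <= err k &
  forall xs, x k.+1 - xs = (x k - xs - lambda k *: d k) + lambda k *: e.
Proof.
set y := x k - gamma k *: U k (grad (x k) + b k).
exists (prox_ k y - p k + a k); last first.
  move=> xs; rewrite xE -/y dE.
  move: (prox_ k y) => r.
  have -> : r + a k - x k = (r - p k + a k) - (x k - p k).
    by rewrite opprB addrA (addrAC (r - p k)) subrK.
  by rewrite scalerBr addrAC -[RHS]addrA (addrC (- _)).
rewrite (wnormZ _ (W k)) ?(ltW (lambda0 k))// /err ler_wpM2l ?(ltW (lambda0 k))//.
apply: le_trans (ler_wnormD (@Wsym k) (@Wpsd k) _ _) _; apply: lerD => //.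
have mu'0 : 0 < mu^-1 by rewrite invr_gt0.
rewrite pE; apply: le_trans (wnorm_prox_le hdot (@Wcont k) (@Wsym k) mu'0
  (Wcoer k) g_proper g_lsc g_convex sub0 (gamma0 k) _ _) _.
have -> : y - (x k - gamma k *: U k (grad (x k))) = - (gamma k *: U k (b k)).
  rewrite /y (linearD (U k)) scalerDr opprB addrC addrA subrK.
  by rewrite opprD addrA subrr add0r.
rewrite wnormN (wnormZ _ (W k)) ?(ltW (gamma0 k))// -mulrA.
by apply: ler_pM => //; [exact: ltW|exact: wnorm_ge0].
Qed.

Lemma quasi_fejer_step xs k : n xs k.+1 <= (1 + eta k) * (m xs k + err k).
Proof.
have [e he xsE] := iter_error k.
have eta1 : 1 <= 1 + eta k by rewrite lerDl.
apply: le_trans (_ : (1 + eta k) * wnorm dot (W k) (x k.+1 - xs) <= _).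
  rewrite -(@ler_pXn2r _ 2)// ?nnegrE ?mulr_ge0 ?wnorm_ge0 ?(le_trans ler01)//.
  rewrite exprMn !sqr_wnorm//; apply: le_trans (Wmono _ _) _.
  by rewrite ler_wpM2r// expr2 ler_peMl// (le_trans ler01).
rewrite ler_wpM2l ?(le_trans ler01)// xsE.
apply: le_trans (ler_wnormD (@Wsym k) (@Wpsd k) _ _) _.
by rewrite lerD2l.
Qed.

Lemma sqr_wnorm_step xs k : n xs k ^+ 2 - m xs k ^+ 2 =
  2 * lambda k * dot (W k (d k)) (x k - xs) - lambda k ^+ 2 * dot (W k (d k)) (d k).
Proof.
rewrite !sqr_wnorm//; move: (x k - xs) => z.
rewrite (linearB (W k)) (linearZ_LR (W k))/= !dotE (@Wsym k z (d k)).
by rewrite (dotC dot z (W k (d k))); ring.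
Qed.

Lemma relaxed_distance_le xs k : Omega xs -> m xs k <= n xs k.
Proof.
move=> hxs.
rewrite -(@ler_pXn2r _ 2)// ?nnegrE ?wnorm_ge0// -subr_ge0 sqr_wnorm_step.
have := step_wnorm_le hdot (@Wpsd k) beta0 (gamma0 k) (NW k) (iter_monotone k hxs)
  (iter_cocoercive xs k).
move=> /(_ ((4 * beta - gamma k * N k) / (2 * beta) - 1) (lexx _)).
have -> : 1 + ((4 * beta - gamma k * N k) / (2 * beta) - 1) =
  (4 * beta - gamma k * N k) / (2 * beta) by rewrite addrC subrK.
move: (lambda0 k) (lambda_le k) (Wpsd k (d k)).
move: (dot (W k (d k)) (d k)) (dot (W k (d k)) (x k - xs)).
move: ((4 * beta - gamma k * N k) / (2 * beta)) (lambda k).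
move=> r l w q l0 lr w0 hq.
have : 0 <= l * ((r - l) * w).
  by rewrite mulr_ge0 ?(ltW l0)// mulr_ge0// subr_ge0.
have : l * (2^-1 * r * w) <= l * q by rewrite ler_wpM2l// ltW.
lra.
Qed.

Lemma iter_distance_cvg xs : Omega xs -> cvgn (n xs).
Proof.
move=> hxs; apply: (quasi_fejer_cvg _ eta0 err0 eta_sum err_sum).
  by move=> k; exact: wnorm_ge0.
move=> k; apply: le_trans (quasi_fejer_step xs k) _.
by rewrite ler_wpM2l ?addr_ge0// lerD2r relaxed_distance_le.
Qed.

Let iter_bounded : exists2 Z, 0 <= Z &
  forall k, `|x k - xs0| <= Z /\ `|d k| <= Z.
Proof.
have /cvg_seq_bounded/pinfty_ex_gt0[B B0 HB] := iter_distance_cvg Omega_xs0.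
have nB k : n xs0 k <= B.
  by apply: le_trans (ler_norm _) _; exact: HB.
have Z0 : 0 <= 2 * (Num.sqrt mu * B) by rewrite !mulr_ge0 ?sqrtr_ge0// ltW.
have le_Z v k : wnorm dot (W k) v <= 2 * B -> `|v| <= 2 * (Num.sqrt mu * B).
  move=> hv; rewrite -(@ler_pXn2r _ 2)// ?nnegrE//.
  apply: le_trans (muW k v) _; rewrite -(sqr_wnorm (@Wpsd k)).
  have -> : (2 * (Num.sqrt mu * B)) ^+ 2 = mu * (2 * B) ^+ 2.
    by rewrite mulrCA exprMn sqr_sqrtr// ltW.
  rewrite ler_wpM2l ?(ltW mu0)// ler_pXn2r// nnegrE ?wnorm_ge0//.
  by rewrite mulr_ge0// ltW.
exists (2 * (Num.sqrt mu * B)) => // k; split; apply: (le_Z _ k).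
  by apply: le_trans (nB k) _; have := B0; lra.
have := step_wnorm_le hdot (@Wpsd k) beta0 (gamma0 k) (NW k)
  (iter_monotone k Omega_xs0) (iter_cocoercive xs0 k) (kappa_le k).
have := dot_le_wnorm (@Wsym k) (@Wpsd k) (d k) (x k - xs0).
rewrite -(sqr_wnorm (@Wpsd k)) -/(n xs0 k).
move: (nB k) (wnorm_ge0 dot (W k) (x k - xs0)); rewrite -/(n xs0 k).
move: (n xs0 k) (dot _ _) => nk q nkB nk0.
have := wnorm_ge0 dot (W k) (d k); move: (wnorm _ _ _) => w w0 h1 h2.
have h3 : w * w <= w * (2 * nk).
  have : 0 <= kappa * w ^+ 2 by rewrite mulr_ge0 ?sqr_ge0// ltW.
  by move: h2; rewrite expr2; lra.
move: w0; rewrite le_eqVlt => /predU1P[<-|w0]; first by rewrite mulr_ge0// ltW.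
by move: h3; rewrite ler_pM2l//; lra.
Qed.

(* The distances to [xs0] before and after the exact relaxed step have the same
   limit, hence the decrease of their squares tends to [0]. *)
Let delta k := (n xs0 k ^+ 2 - m xs0 k ^+ 2) / (2 * lmin * gmin).

Let delta_cvg0 : delta k @[k --> \oo] --> (0 : R).
Proof.
have nc : n xs0 k @[k --> \oo] --> limn (n xs0) by exact: iter_distance_cvg.
have mc : m xs0 k @[k --> \oo] --> limn (n xs0).
  apply: (quasi_fejer_mid_cvg eta0 err0 eta_sum err_sum (iter_distance_cvg Omega_xs0)).
    by move=> k; exact: relaxed_distance_le.
  by move=> k; exact: quasi_fejer_step.
have -> : (0 : R) =
    (limn (n xs0) * limn (n xs0) - limn (n xs0) * limn (n xs0)) / (2 * lmin * gmin).
  by rewrite subrr mul0r.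
apply: cvgM; last exact: cvg_cst.
by apply: cvgB; under eq_fun do rewrite expr2; apply: cvgM.
Qed.

Let v k := grad (x k) - grad xs0 - (2 * beta)^-1 *: d k.

Let iter_slack k :
  [/\ dot (grad (x k) - grad xs0) (x k - xs0)
        - beta * `|grad (x k) - grad xs0| ^+ 2 <= delta k,
      beta * `|v k| ^+ 2 <= delta k &
      N k * dot (W k (d k)) (d k) - `|d k| ^+ 2 <= 4 * beta * delta k].
Proof.
apply: (step_slack hdot (@Wpsd k) beta0 (NW k)
  (iter_monotone k Omega_xs0) (iter_cocoercive xs0 k) lmin0 (lmin_le k)
  (lambda_le k) gmin0 (gmin_le k)).
rewrite -sqr_wnorm_step /delta mulrCA divff ?mulr1//.
by rewrite gt_eqF// !mulr_gt0.
Qed.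

Let sqrt_delta_cvg0 c : Num.sqrt (c * delta k) @[k --> \oo] --> (0 : R).
Proof.
have -> : (0 : R) = Num.sqrt (c * 0) by rewrite mulr0 sqrtr0.
have cd : c * delta k @[k --> \oo] --> c * 0 by apply: cvgM => //; exact: cvg_cst.
exact: (cvg_comp _ _ cd (@sqrt_continuous R (c * 0))).
Qed.

Let norm_v_le k : `|v k| <= Num.sqrt (beta^-1 * delta k).
Proof.
rewrite -[`|v k|]ger0_norm// -sqrtr_sqr ler_wsqrtr//.
by rewrite ler_pdivlMl//; case: (iter_slack k).
Qed.

(** The slacks of the averagedness inequality tend to [0] because [lambda] and
    [gamma] stay away from [0], and the iterates are bounded. *)
Lemma iter_residual_cvg0 : `|d k| @[k --> \oo] --> (0 : R).
Proof.
have [Z Z0 HZ] := iter_bounded.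
pose K := Num.sqrt (mu * (alpha^-1 * Z ^+ 2)).
(* The right-hand side of [step_bound], with each slack replaced by its bound. *)
pose rho k := 2 * beta * delta k
  + 2 * beta * (Num.sqrt (beta^-1 * delta k) * (Z + Z))
  + 2 * beta * delta k + Num.sqrt (4 * beta * delta k) * K.
have rho0 : rho k @[k --> \oo] --> (0 : R).
  have -> : (0 : R) = 2 * beta * 0 + 2 * beta * (0 * (Z + Z)) + 2 * beta * 0 + 0 * K.
    by rewrite !(mulr0, mul0r, addr0).
  have cst c : (fun=> c) k @[k --> \oo] --> (c : R) by exact: cvg_cst.
  apply: cvgD; last by apply: cvgM => //; exact: sqrt_delta_cvg0.
  apply: cvgD; last by apply: cvgM.
  apply: cvgD; first by apply: cvgM.
  by apply: cvgM => //; apply: cvgM => //; exact: sqrt_delta_cvg0.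
have le_rho k : 2^-1 * kappa * `|d k| ^+ 2 <= rho k.
  have [zZ dZ] := HZ k; have [s1 s2 s3] := iter_slack k.
  have N0 : 0 <= N k by case: (Upos k) => Ub _ _; exact: opnorm_ge0.
  apply: le_trans (step_bound hdot (@Wsym k) (@Wpsd k) beta0 (gamma0 k) (NW k)
    (iter_monotone k Omega_xs0) (iter_cocoercive xs0 k) N0 (kappa_le k) (ltW kappa0)) _.
  have b2 : 0 <= 2 * beta by rewrite mulr_ge0// ltW.
  apply: lerD; first apply: lerD; first apply: lerD.
  - by rewrite ler_wpM2l.
  - rewrite ler_wpM2l//; apply: ler_pM; rewrite ?addr_ge0//; last exact: lerD.
    exact: norm_v_le.
  - by rewrite ler_wpM2l.
  - apply: ler_pM; rewrite ?sqrtr_ge0//; apply: ler_wsqrtr => //.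
    apply: le_trans (_ : N k * dot (W k (x k - xs0)) (x k - xs0) <= _).
      by rewrite gerBl.
    apply: ler_pM => //; apply: le_trans (Wle k _) _.
    by rewrite ler_wpM2l ?invr_ge0 ?(ltW alpha0)// lerXn2r// nnegrE.
have sq0 : `|d k| ^+ 2 @[k --> \oo] --> (0 : R).
  apply: (@squeeze_cvgr _ _ _ _ (fun=> 0) (fun k => (2^-1 * kappa)^-1 * rho k)).
  - near=> k; rewrite sqr_ge0/= -ler_pdivrMl ?invr_gt0 ?mulr_gt0// invrK.
    exact: le_rho.
  - exact: cvg_cst.
  - by rewrite -(mulr0 (2^-1 * kappa)^-1); apply: cvgM => //; exact: cvg_cst.
have := cvg_comp _ _ sq0 (@sqrt_continuous R 0).
rewrite sqrtr0; apply: cvg_trans; apply: near_eq_cvg; near=> k.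
by rewrite /= sqrtr_sqr normr_id.
Unshelve. all: by end_near. Qed.

Lemma iter_gradient_cvg xs : Omega xs -> grad (x k) @[k --> \oo] --> grad xs.
Proof.
move=> hxs; rewrite (gradient_argmin_unique hxs Omega_xs0).
apply/subr_cvg0/norm_cvg0P.
apply: (@squeeze_cvgr _ _ _ _ (fun=> 0)
  (fun k => Num.sqrt (beta^-1 * delta k) + (2 * beta)^-1 * `|d k|)).
- near=> k; rewrite normr_ge0/=.
  have -> : grad (x k) - grad xs0 = v k + (2 * beta)^-1 *: d k by rewrite subrK.
  apply: le_trans (ler_normD _ _) _; apply: lerD; first exact: norm_v_le.
  by rewrite normrZ ger0_norm// invr_ge0 mulr_ge0// ltW.
- exact: cvg_cst.
- rewrite -[X in _ --> X]addr0; apply: cvgD; first exact: sqrt_delta_cvg0.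
  rewrite -(mulr0 (2 * beta)^-1); apply: cvgM; first exact: cvg_cst.
  exact: iter_residual_cvg0.
Unshelve. all: by end_near. Qed.

Let x_bounded : exists M, forall k, `|x k| <= M.
Proof.
have [Z _ HZ] := iter_bounded; exists (Z + `|xs0|) => k.
rewrite -[x k](subrK xs0) (le_trans (ler_normD _ _))// lerD2r.
by case: (HZ k).
Qed.

Section WeakLimits.
Variables (F : set_system nat) (FF : ProperFilter F) (q : H).
Hypotheses (ooF : \oo `<=` F) (xq : forall h, dot (x k) h @[k --> F] --> dot q h).

(** The gradients converge strongly and the iterates weakly, so the right-hand
    side of the cocoercivity inequality at [q] tends to [0]. *)
Lemma gradient_weak_limit : grad q = grad xs0.
Proof.
have [M HM] := x_bounded.
have gx : grad (x k) @[k --> F] --> grad xs0.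
  exact: cvg_finer_filter ooF (iter_gradient_cvg Omega_xs0).
have gB : grad (x k) - grad q @[k --> F] --> grad xs0 - grad q.
  by apply: cvgB; [exact: gx|exact: cvg_cst].
have e : dot (grad xs0 - grad q) (q - q) = 0.
  by move: (grad xs0 - grad q) => w; rewrite subrr dot0r.
have lim : dot (grad (x k) - grad q) (x k - q) @[k --> F] --> (0 : R).
  rewrite -[X in _ --> X]e.
  apply: (@cvg_dot_strong_weak _ _ _ hdot _ F _ _ _ (M + `|q|) _ _ gB).
  - by move=> k; rewrite (le_trans (ler_normB _ _))// lerD2r.
  - move=> h; under eq_fun do rewrite dotDl.
    by rewrite dotDl; apply: cvgD; [exact: xq|exact: cvg_cst].
have nlim : beta * (`|grad (x k) - grad q| * `|grad (x k) - grad q|) @[k --> F] -->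
    beta * (`|grad xs0 - grad q| * `|grad xs0 - grad q|).
  have nB : `|grad (x k) - grad q| @[k --> F] --> `|grad xs0 - grad q|.
    exact: cvg_norm.
  by apply: cvgM; [exact: cvg_cst|exact: cvgM].
have : beta * (`|grad xs0 - grad q| * `|grad xs0 - grad q|) <= 0.
  apply: (ler_cvg_to nlim lim); near=> k.
  rewrite -expr2; exact: (gradient_cocoercive hdot f_convex f_diff beta0 grad_lip).
move=> h; apply/esym/eqP; rewrite -subr_eq0 -normr_eq0.
move: h; move: `|_| => r; rewrite pmulr_rle0// -expr2 => h.
by rewrite -sqrf_eq0 eq_le h sqr_ge0.
Unshelve. all: by end_near. Qed.

Lemma weak_limit_argmin : Omega q.
Proof.
apply: subgradient_argmin_sum; rewrite gradient_weak_limit.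
have [M HM] := x_bounded; have [Z Z0 HZ] := iter_bounded.
have d0 : d k @[k --> \oo] --> (0 : H) by apply/norm_cvg0P; exact: iter_residual_cvg0.
apply: (@subgradient_weak_closed F _ p
  (fun k => (gamma k)^-1 *: W k (d k) - grad (x k)) (M + Z)).
- move=> k; have -> : p k = x k - d k by rewrite dE subKr.
  by rewrite (le_trans (ler_normB _ _))// lerD//; case: (HZ k).
- exact: iter_subgradient.
- move=> h; have -> : dot q h = dot q h - dot 0 h by rewrite dot0l subr0.
  have dh : dot (d k) h @[k --> F] --> dot 0 h.
    by apply: (cvg_dot hdot); [exact: cvg_finer_filter ooF d0|exact: cvg_cst].
  have -> : (fun k => dot (p k) h) = (fun k => dot (x k) h - dot (d k) h).
    by apply/funext => k; rewrite dE -dotNl -dotDl subKr.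
  by apply: cvgB => //; exact: xq.
- apply: (cvg_finer_filter ooF); rewrite -(add0r (- grad xs0)).
  apply: cvgB; last exact: (iter_gradient_cvg Omega_xs0).
  apply/norm_cvg0P.
  apply: (@squeeze_cvgr _ _ _ _ (fun=> 0) (fun k => gmin^-1 * (alpha^-1 * `|d k|))).
  + near=> k; rewrite normr_ge0/= normrZ ger0_norm ?invr_ge0 ?(ltW (gamma0 k))//.
    apply: ler_pM; rewrite ?invr_ge0 ?(ltW (gamma0 k))//.
      by rewrite lef_pV2 ?posrE.
    exact: (opinv_norm_le hdot alpha0 (Upos k) (WK k)).
  + exact: cvg_cst.
  + rewrite -(mulr0 gmin^-1) -(mulr0 alpha^-1).
    apply: cvgM; first exact: cvg_cst.
    by apply: cvgM; [exact: cvg_cst|exact: iter_residual_cvg0].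
Unshelve. all: by end_near. Qed.

End WeakLimits.

Let W_cvg w : cvgn (fun k => W k w).
Proof.
have alphaV0 : 0 < alpha^-1 by rewrite invr_gt0.
exact: (monotone_metrics_cvg hdot Wsym Wpsd alphaV0 Wle eta0 eta_sum Wmono).
Qed.

(** Opial's argument for variable metrics: the squared distances of [x k] to two
    minimisers converge, and their difference is affine in [x k] with linear
    part [- 2 W k (q1 - q2)], which converges strongly; so the limit of
    [<W k (q1 - q2), x k>] can be computed along either filter. *)
Lemma weak_limit_unique (F1 F2 : set_system nat) (FF1 : ProperFilter F1)
    (FF2 : ProperFilter F2) q1 q2 : \oo `<=` F1 -> \oo `<=` F2 ->
  (forall h, dot (x k) h @[k --> F1] --> dot q1 h) ->
  (forall h, dot (x k) h @[k --> F2] --> dot q2 h) -> q1 = q2.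
Proof.
move=> oo1 oo2 h1 h2; pose w := q1 - q2.
have [M HM] := x_bounded.
have cstc (c : H) : (fun=> c) k @[k --> \oo] --> c by exact: cvg_cst.
have sqr_cvg q : Omega q -> cvgn (fun k => n q k * n q k).
  by move=> hq; apply: cvgP; apply: cvgM; exact: iter_distance_cvg.
have quad_cvg q : cvgn (fun k => dot (W k q) q).
  by apply: cvgP; apply: (cvg_dot hdot); [exact: W_cvg|exact: cstc].
have cross : cvgn (fun k => dot (W k w) (x k)).
  have O1 := weak_limit_argmin FF1 oo1 h1; have O2 := weak_limit_argmin FF2 oo2 h2.
  have -> : (fun k => dot (W k w) (x k)) = (fun k => 2^-1 *
     ((n q2 k * n q2 k - n q1 k * n q1 k) + (dot (W k q1) q1 - dot (W k q2) q2))).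
    apply/funext => k; rewrite -!expr2 !sqr_wnorm// /w !(linearB (W k)) !dotE.
    rewrite (@Wsym k (x k) q1) (@Wsym k (x k) q2) !(dotC dot (x k) (W k _)).
    by field.
  apply: cvgP; apply: cvgM; first exact: cvg_cst.
  apply: cvgD; apply: cvgB.
  - exact: (sqr_cvg _ O2).
  - exact: (sqr_cvg _ O1).
  - exact: quad_cvg.
  - exact: quad_cvg.
have lim (F : set_system nat) (FF : ProperFilter F) q : \oo `<=` F ->
    (forall h, dot (x k) h @[k --> F] --> dot q h) ->
    dot (limn (fun k => W k w)) q = limn (fun k => dot (W k w) (x k)).
  move=> ooF hq.
  have l1 : dot (W k w) (x k) @[k --> F] --> dot (limn (fun k => W k w)) q.
    apply: (@cvg_dot_strong_weak _ _ _ hdot _ F _ _ _ M _ _ _ HM hq).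
    have Ww : W k w @[k --> \oo] --> limn (fun k => W k w) by exact: W_cvg.
    exact: cvg_finer_filter ooF Ww.
  have l2 : dot (W k w) (x k) @[k --> F] --> limn (fun k => dot (W k w) (x k)).
    have Wx : dot (W k w) (x k) @[k --> \oo] --> limn (fun k => dot (W k w) (x k)).
      exact: cross.
    exact: cvg_finer_filter ooF Wx.
  exact: (@cvg_unique R^o _ _ _ _ _ l1 l2).
have w0 : dot (limn (fun k => W k w)) w = 0.
  by rewrite /w dotDr dotNr (lim F1)// (lim F2)// subrr.
have ww : mu^-1 * `|w| ^+ 2 <= 0.
  have l1 : dot (W k w) w @[k --> \oo] --> dot (limn (fun k => W k w)) w.
    by apply: (cvg_dot hdot); [exact: W_cvg|exact: cstc].
  rewrite -w0; apply: (cvgr_to_ge l1); near=> k; exact: Wcoer.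
apply/eqP; rewrite -subr_eq0 -/w -normr_eq0 -sqrf_eq0 eq_le sqr_ge0 andbT.
by move: ww; rewrite pmulr_rle0// invr_gt0.
Unshelve. all: by end_near. Qed.

Lemma iter_weakly_cvg : exists2 q, Omega q & weakly_cvg dot x q.
Proof.
have [M HM] := x_bounded.
have [F [UF ooF]] := @ultraFilterLemma nat \oo _.
have [q xq] := weak_ultra_limit hdot UF HM.
exists q; first exact: (weak_limit_argmin _ ooF xq).
apply: (weakly_cvg_unique_limit hdot HM) => G r UG ooG xr.
exact: (weak_limit_unique _ _ ooG ooF xr xq).
Qed.

End Iteration.
End ForwardBackward.

(** * The variable metric forward-backward algorithm *)

Theorem corollary3p4 (R : realType) (H : completeNormedModType R)
  (dot : {dot H for idfun}) (hdot : induces_norm dot)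
  (g : H -> \bar R) (g_proper : proper_fun g)
  (g_lsc : lower_semicontinuous g) (g_convex : convex_efun g)
  (f : H -> R) (f_convex : convex_function [set: H] f)
  (f_diff : forall x : H, differentiable f x)
  (beta : R) (beta_gt0 : 0 < beta)
  (grad_lip : (1 / beta).-lipschitz (gradient dot f))
  (Omega : set H) (OmegaE : Omega = argmin (fun x => (f x)%:E + g x)%E)
  (Omega_neq0 : Omega !=set0)
  (alpha : R) (alpha_gt0 : 0 < alpha)
  (eta : nat -> R) (eta_ge0 : forall k, 0 <= eta k)
  (eta_sum : (\sum_(0 <= k <oo) (eta k)%:E < +oo)%E)
  (U : nat -> {linear H -> H})
  (U_pos : forall k, strongly_positive_ops dot alpha (U k))
  (mu : R) (muE : ereal_sup [set (opnorm (U k))%:E | k in [set: nat]] = mu%:E)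
  (U_mono : forall k,
     loewner_ge dot (fun x => (1 + eta k) *: U k.+1 x) (U k))
  (gamma : nat -> R)
  (gamma_bnd : forall k, 0 < gamma k < 2 * beta / opnorm (U k))
  (alpha_ : nat -> R)
  (alpha_E : forall k,
     alpha_ k = 2 * beta / (4 * beta - gamma k * opnorm (U k)))
  (lambda : nat -> R) (lambda_bnd : forall k, 0 < lambda k < 1 / alpha_ k)
  (a b : nat -> H)
  (a_sum : (\sum_(0 <= k <oo) (lambda k * `|a k|)%:E < +oo)%E)
  (b_sum : (\sum_(0 <= k <oo) (lambda k * `|b k|)%:E < +oo)%E)
  (conds :
    (* (A) *)
    (exists lambda_ tau gamma_ eps : R,
      [/\ 0 < lambda_ /\ (forall k, lambda_ <= lambda k <= 1 / alpha_ k - tau),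
          (forall k, 0 < tau < 1 / alpha_ k - lambda_),
          0 < gamma_ /\ (forall k, gamma_ <= gamma k <= (2 * beta - eps) / mu)
        & 0 < eps < 2 * beta - mu * gamma_])
    \/
    (* (B) *)
    ((\sum_(0 <= k <oo) (lambda k * (1 / alpha_ k - lambda k))%:E = +oo)%E /\
     (exists gamma_ eps : R,
       [/\ 0 < gamma_,
           (forall k, gamma_ <= gamma k <= (2 * beta - eps) / mu)
         & 0 < eps < 2 * beta - mu * gamma_]) /\
     (\sum_(0 <= k <oo) `|gamma k.+1 - gamma k|%:E < +oo)%E /\
     (\sum_(0 <= k <oo)
        `|gamma k.+1 * opnorm (U k.+1) - gamma k * opnorm (U k)|%:E
        < +oo)%E /\
     (forall z : H,
        (\sum_(0 <= k <oo) `|opinv (U k) z - opinv (U k.+1) z|%:E < +oo)%E) /\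
     (exists lambda_ : R, 0 < lambda_ /\ (forall k, lambda_ <= lambda k))))
  (x y : nat -> H)
  (yE : forall k,
     y k = x k - gamma k *: U k (gradient dot f (x k) + b k))
  (xE : forall k,
     x k.+1 = x k + lambda k *:
       (prox dot (opinv (U k)) (fun z => (gamma k)%:E * g z)%E (y k)
        + a k - x k)) :
  [/\ (* (i) *)
      forall xs, Omega xs -> cvgn (fun k => wnorm dot (opinv (U k)) (x k - xs)),
      (* (ii) *)
      `|x k - prox dot (opinv (U k)) (fun z => (gamma k)%:E * g z)%E
                (x k - gamma k *: U k (gradient dot f (x k)))|
        @[k --> \oo] --> (0 : R),
      (* (iii) *)
      exists2 xb, Omega xb & weakly_cvg dot x xb
    & (* (iv) *)
      forall xs, Omega xs ->
        gradient dot f (x k) @[k --> \oo] --> gradient dot f xs].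

Proof.
(* Both sets of conditions bound [lambda] and [gamma] from below, and keep
   [gamma k * mu] at most [2 beta - eps]. *)
have [lmin [gmin [eps [lmin0 lmin_le gmin0 gamma_le eps_bnd]]]] :
  exists lmin gmin eps : R,
  [/\ 0 < lmin, (forall k, lmin <= lambda k), 0 < gmin,
    (forall k, gmin <= gamma k <= (2 * beta - eps) / mu) &
    0 < eps < 2 * beta - mu * gmin].
  case: conds => [[l [tau [gm [ep [[l0 lb] _ [g0 gb] eb]]]]]|
      [_ [[gm [ep [g0 gb eb]]] [_ [_ [_ [l [l0 lb]]]]]]]]; exists l, gm, ep.
    by split=> // k; case/andP: (lb k).
  by [].
pose N k := opnorm (U k).
have N_le k : N k <= mu.
  by rewrite -lee_fin -muE; apply: ereal_sup_ubound; exists k.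
have N_gt0 k : 0 < N k.
  rewrite lt_neqAle eq_sym; apply/andP; split; last first.
    by case: (U_pos k) => Ub _ _; exact: opnorm_ge0.
  apply/negP => /eqP N0; have := gamma_bnd k.
  by rewrite -/(N k) N0 invr0 mulr0 => /andP[/lt_trans h /h]; rewrite ltxx.
have mu0 : 0 < mu by exact: lt_le_trans (N_gt0 0%N) (N_le 0%N).
have gamma0 k : 0 < gamma k by case/andP: (gamma_bnd k).
have [eps0 eps_lt] := andP eps_bnd.
have step_lt k : gamma k * N k <= 2 * beta - eps.
  have [_ gk] := andP (gamma_le k).
  have e0 : 0 < 2 * beta - eps.
    by have := lt_le_trans (gamma0 k) gk; rewrite pmulr_lgt0// invr_gt0.
  apply: le_trans (_ : (2 * beta - eps) / mu * mu <= _); last first.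
    by rewrite divfK// gt_eqF.
  by apply: ler_pM => //; exact: ltW.
have alphaVE k : 1 / alpha_ k = (4 * beta - gamma k * N k) / (2 * beta).
  by rewrite alpha_E div1r invf_div.
have [W HW] := choice (fun k => opinv_linear hdot alpha_gt0 (U_pos k)).
have WE k : opinv (U k) = W k by case: (HW k).
have WK k : cancel (W k) (U k) by case: (HW k).
have UK k : cancel (U k) (W k) by case: (HW k).
pose P k v := prox dot (W k) (fun z => (gamma k)%:E * g z)%E v.
pose p k := P k (x k - gamma k *: U k (gradient dot f (x k))).
pose d k := x k - p k.
have xE' k : x k.+1 = x k + lambda k *:
    (P k (x k - gamma k *: U k (gradient dot f (x k) + b k)) + a k - x k).
  by rewrite xE yE WE.
have lambda_gt0 k : 0 < lambda k by case/andP: (lambda_bnd k).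
have lambda_le k : lambda k <= (4 * beta - gamma k * N k) / (2 * beta).
  by rewrite -alphaVE ltW//; case/andP: (lambda_bnd k).
have kappa0 : 0 < eps / (2 * beta) by rewrite divr_gt0// mulr_gt0.
have kappa_le k : eps / (2 * beta) <= (4 * beta - gamma k * N k) / (2 * beta) - 1.
  have -> : (4 * beta - gamma k * N k) / (2 * beta) - 1 =
      (2 * beta - gamma k * N k) / (2 * beta) by field; rewrite gt_eqF.
  rewrite ler_pM2r ?invr_gt0 ?mulr_gt0//.
  by have := step_lt k; lra.
have eta_s := bounded_sums_nneseries eta_ge0 eta_sum.
have a_s : bounded_sums (fun k => lambda k * `|a k|).
  by apply: bounded_sums_nneseries a_sum => k; rewrite mulr_ge0// ltW.
have b_s : bounded_sums (fun k => lambda k * `|b k|).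
  by apply: bounded_sums_nneseries b_sum => k; rewrite mulr_ge0// ltW.
have gmin_le k : gmin <= gamma k by case/andP: (gamma_le k).
have gmax_ge k : gamma k <= (2 * beta - eps) / mu by case/andP: (gamma_le k).
have pE k : p k = P k (x k - gamma k *: U k (gradient dot f (x k))) by [].
have dE k : d k = x k - p k by [].
have [xs0 Oxs0] := Omega_neq0; rewrite OmegaE in Oxs0 *.
split.
- move=> xs Oxs; under eq_fun do rewrite WE.
  exact: (iter_distance_cvg hdot g_proper g_lsc g_convex f_convex f_diff beta_gt0 grad_lip
    Oxs0 alpha_gt0 mu0 U_pos WK UK N_le U_mono eta_ge0 eta_s gmin0 gmin_le
    gmax_ge lmin0 lmin_le lambda_le a_s b_s xE' pE dE Oxs).
- under eq_fun do rewrite WE.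
  exact: (iter_residual_cvg0 hdot g_proper g_lsc g_convex f_convex f_diff beta_gt0
    grad_lip Oxs0 alpha_gt0 mu0 U_pos WK UK N_le U_mono eta_ge0 eta_s gmin0
    gmin_le gmax_ge kappa0 kappa_le lmin0 lmin_le lambda_le a_s b_s xE' pE dE).
- exact: (iter_weakly_cvg hdot g_proper g_lsc g_convex f_convex f_diff beta_gt0
    grad_lip Oxs0 alpha_gt0 mu0 U_pos WK UK N_le U_mono eta_ge0 eta_s gmin0
    gmin_le gmax_ge kappa0 kappa_le lmin0 lmin_le lambda_le a_s b_s xE' pE dE).
- move=> xs Oxs.
  exact: (iter_gradient_cvg hdot g_proper g_lsc g_convex f_convex f_diff beta_gt0
    grad_lip Oxs0 alpha_gt0 mu0 U_pos WK UK N_le U_mono eta_ge0 eta_s gmin0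
    gmin_le gmax_ge kappa0 kappa_le lmin0 lmin_le lambda_le a_s b_s xE' pE dE Oxs).
Qed.
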